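(* Let $\Bbbk$ be a field, let $Q=\Bbbk[[x,y,z]]$ be the power series ring in three variables, and consider the following ideals in $Q$: $$\begin{aligned} \mathfrak{b}_1 &= (x^3,\; x^2y,\; yz^2,\; z^3),\\ \mathfrak{b}_2 &= \mathfrak{b}_1 + (xyz),\\ \mathfrak{b}_3 &= \mathfrak{b}_2 + (xy^2-y^3),\\ \mathfrak{b}_4 &= \mathfrak{b}_3 + (y^2z). \end{aligned}$$ Then for each $n\in\{1,2,3,4\}$ the local ring $Q/\mathfrak{b}_n$ has embedding codepth $3$ and belongs to the class $\mathbf{B}$. Moreover, $Q/\mathfrak{b}_1$ and $Q/\mathfrak{b}_2$ have type $1$, while $Q/\mathfrak{b}_3$ and $Q/\mathfrak{b}_4$ have type $3$.
   Context: Let $R$ be a commutative noetherian local ring with maximal ideal $\mathfrak{m}$ and residue field $k=R/\mathfrak{m}$. The embedding dimension $e$ of $R$ is the minimal number of generators of $\mathfrak{m}$; with $d$ the depth of $R$, the embedding codepth of $R$ is $e-d$. The type of $R$ is $\operatorname{rank}_k \operatorname{Ext}_R^d(k,R)$; for a ring of depth $0$ this is the $k$-vector space dimension of the socle $(0:\mathfrak{m})$. Suppose $R=Q/I$ has embedding codepth $3$, where $Q$ is a complete regular local ring with residue field $k$ and with the same embedding dimension as $R$. The minimal free resolution of $R$ over $Q$ has the form $$F \;=\; 0 \to Q^n \to Q^m \to Q^{l+1} \to Q \to 0,$$ where $n$ is the type of $R$, $l+1=\mu(I)$ is the minimal number of generators of $I$, and $m=n+l$. It carries a structure of a graded-commutative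 differential graded algebra (Buchsbaum–Eisenbud), and the induced graded-commutative $k$-algebra structure on $A=\operatorname{H}(F\otimes_Q k)=\operatorname{Tor}^Q_*(R,k)$ is unique up to isomorphism. The graded algebra $A$ is isomorphic to the homology algebra $\operatorname{H}(K^R)$ of the Koszul complex $K^R$ on a minimal set of generators of $\mathfrak{m}$. Graded-commutativity means that, for $\mathbf{e}_i,\mathbf{e}_j\in A_1$ and $\mathbf{f}_j\in A_2$, one has $\mathbf{e}_i\mathbf{e}_j=-\mathbf{e}_j\mathbf{e}_i$, $\mathbf{e}_i^2=0$, and $\mathbf{e}_i\mathbf{f}_j=\mathbf{f}_j\mathbf{e}_i$. Class $\mathbf{B}$: the ring $R$ belongs to $\mathbf{B}$ if there exist $k$-bases $\mathbf{e}_1,\dots,\mathbf{e}_{l+1}$ of $A_1$, $\mathbf{f}_1,\dots,\mathbf{f}_m$ of $A_2$, and $\mathbf{g}_1,\dots,\mathbf{g}_n$ of $A_3$ such that $$\mathbf{e}_1\mathbf{e}_2=\mathbf{f}_3,\qquad \mathbf{e}_1\mathbf{f}_1=\mathbf{g}_1,\qquad \mathbf{e}_2\mathbf{f}_2=\mathbf{g}_1,$$ and all other products of these basis elements that are not determined by these equalities via graded-commutativity are zero. *)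

(* Defs.v *)
From HB Require Import structures.
From mathcomp Require Import all_boot all_algebra.
From mathcomp Require Import boolp.

Set Implicit Arguments.
Unset Strict Implicit.
Unset Printing Implicit Defensive.

Import GRing.Theory.
Local Open Scope ring_scope.


Section LocalRings.
Variable R : comNzRingType.

Definition gen_ideal (s : seq R) : {pred R} :=
  fun x => `[< exists c : 'I_(size s) -> R, x = \sum_(i < size s) c i * s`_i >].

(* A commutative ring is local iff its nonunits form an ideal, which is then
   its unique maximal ideal; closure under multiplication by scalars is
   automatic for nonunits. *)
Definition maxideal (x : R) : Prop := forall y, y * x <> 1.

Definition local_ring : Prop :=
  forall x y, maxideal x -> maxideal y -> maxideal (x + y).

Definition generates_maxideal (s : seq R) : Prop :=
  forall x, maxideal x <-> x \in gen_ideal s.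

Definition embdim (e : nat) : Prop :=
  (exists s, size s = e /\ generates_maxideal s) /\
  (forall s, generates_maxideal s -> (e <= size s)%N).

(* Regular sequences inside the maximal ideal; the requirement R/(s) <> 0 is
   then automatic for R local. *)
Definition regular_seq (s : seq R) : Prop :=
  (forall x, x \in s -> maxideal x) /\
  (forall i y, (i < size s)%N ->
     s`_i * y \in gen_ideal (take i s) -> y \in gen_ideal (take i s)).

Definition depth (d : nat) : Prop :=
  (exists s, size s = d /\ regular_seq s) /\
  (forall s, regular_seq s -> (size s <= d)%N).

Definition embcodepth (c : nat) : Prop :=
  exists e d : nat, [/\ embdim e, depth d & e = (d + c)%N].

(* For submodules B <= Z of M such that the maximal ideal m annihilates Z/B:
   Z/B has rank n over R/m.  The elements z i represent a basis, and
   coefficients in R/m are represented by elements of R. *)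
Definition residue_rank (M : lmodType R) (Z B : M -> Prop) (n : nat) : Prop :=
  exists z : 'I_n -> M,
    [/\ forall i, Z (z i),
        forall v, Z v -> exists a : 'I_n -> R, B (v - \sum_i a i *: z i)
      & forall a : 'I_n -> R,
          B (\sum_i a i *: z i) <-> (forall i, maxideal (a i))].

(* Degrees 0, ..., d + 1 of a resolution of R/m by finite free modules
     R^(b (d+1)) -> R^(b d) -> ... -> R^(b 0) -> R/m -> 0,
   exact at R/m and in degrees 0, ..., d.  Vectors are rows, D i acts by
   v |-> v *m D i, and the augmentation is v |-> v *m eps mod m. *)
Definition residue_resolution (d : nat) (b : nat -> nat)
    (D : forall i, 'M[R]_(b i.+1, b i)) (eps : 'cV[R]_(b 0%N)) : Prop :=
  [/\ exists v : 'rV_(b 0%N), ~ maxideal ((v *m eps) 0 0),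
      forall v : 'rV_(b 0%N),
        maxideal ((v *m eps) 0 0) <-> exists w, v = w *m D 0%N
    & forall i, (i < d)%N -> forall v : 'rV_(b i.+1),
        v *m D i = 0 <-> exists w, v = w *m D i.+1].

(* The column c : 'cV_(b i) stands for the map v |-> v *m c in Hom(R^(b i), R),
   so that the differential of Hom(P, R) is c |-> D i *m c. *)
Definition ext_cocycle b (D : forall i, 'M[R]_(b i.+1, b i)) d
    (c : 'cV[R]_(b d)) : Prop := D d *m c = 0.

Definition ext_coboundary b (D : forall i, 'M[R]_(b i.+1, b i)) d :
    'cV[R]_(b d) -> Prop :=
  match d with
  | 0 => fun c => c = 0
  | d'.+1 => fun c => exists c', c = D d' *m c'
  end.

(* rank_k Ext^d_R(k, R) = n, for k = R/m.  Only the degrees up to d + 1 of a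
   free resolution of k enter the computation of Ext^d. *)
Definition ext_residue_rank (d n : nat) : Prop :=
  exists b (D : forall i, 'M[R]_(b i.+1, b i)) (eps : 'cV[R]_(b 0%N)),
    residue_resolution d D eps /\
    residue_rank (@ext_cocycle b D d) (@ext_coboundary b D d) n.

Definition cmtype (n : nat) : Prop :=
  exists d, depth d /\ ext_residue_rank d n.

End LocalRings.


(* The bilinear map S^p x S^q -> S^r with values M i j on the standard basis. *)
Definition bilin (S : comNzRingType) p q r (M : 'I_p -> 'I_q -> 'rV[S]_r)
    (u : 'rV[S]_p) (v : 'rV[S]_q) : 'rV[S]_r :=
  \sum_i \sum_j (u 0 i * v 0 j) *: M i j.

(* A minimal free resolution
     F = 0 -> Q^r3 -> Q^r2 -> Q^r1 -> Q -> 0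
   of R (a Q-algebra via the surjection pi), with differentials v |-> v *m d_i,
   and a graded-commutative DG algebra structure on F.  F_0 = Q acts by
   scalars; dg_11 and dg_12 are the tables of F_1 x F_1 -> F_2 and
   F_1 x F_2 -> F_3; the product F_2 x F_1 -> F_3 is given by f u = u f; the
   remaining products vanish for degree reasons.  The axioms are strict graded
   commutativity in degree 1, the Leibniz rule
     d(a b) = d(a) b + (-1)^|a| a d(b)
   in bidegrees (1,1), (1,2), (1,3), (2,2) (in the last two, a b = 0), and
   associativity on F_1 x F_1 x F_1. *)
Record dg_resolution (Q R : comNzRingType) (pi : {rmorphism Q -> R})
    (r1 r2 r3 : nat) := DGResolution {
  dg_d1 : 'M[Q]_(r1, 1);
  dg_d2 : 'M[Q]_(r2, r1);
  dg_d3 : 'M[Q]_(r3, r2);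
  dg_11 : 'I_r1 -> 'I_r1 -> 'rV[Q]_r2;
  dg_12 : 'I_r1 -> 'I_r2 -> 'rV[Q]_r3;
  dg_exact0 : forall q : Q,
    pi q = 0 <-> exists v : 'rV_r1, (v *m dg_d1) 0 0 = q;
  dg_exact1 : forall v : 'rV_r1,
    v *m dg_d1 = 0 <-> exists w : 'rV_r2, v = w *m dg_d2;
  dg_exact2 : forall v : 'rV_r2,
    v *m dg_d2 = 0 <-> exists w : 'rV_r3, v = w *m dg_d3;
  dg_exact3 : forall v : 'rV_r3, v *m dg_d3 = 0 -> v = 0;
  dg_minimal1 : forall i j, maxideal (dg_d1 i j);
  dg_minimal2 : forall i j, maxideal (dg_d2 i j);
  dg_minimal3 : forall i j, maxideal (dg_d3 i j);
  dg_alternating : forall u : 'rV_r1, bilin dg_11 u u = 0;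
  dg_leibniz11 : forall u v : 'rV_r1,
    bilin dg_11 u v *m dg_d2 = (u *m dg_d1) 0 0 *: v - (v *m dg_d1) 0 0 *: u;
  dg_leibniz12 : forall (u : 'rV_r1) (f : 'rV_r2),
    bilin dg_12 u f *m dg_d3
      = (u *m dg_d1) 0 0 *: f - bilin dg_11 u (f *m dg_d2);
  dg_leibniz13 : forall (u : 'rV_r1) (g : 'rV_r3),
    (u *m dg_d1) 0 0 *: g - bilin dg_12 u (g *m dg_d3) = 0;
  dg_leibniz22 : forall f f' : 'rV_r2,
    bilin dg_12 (f *m dg_d2) f' + bilin dg_12 (f' *m dg_d2) f = 0;
  dg_assoc : forall u v w : 'rV_r1,
    bilin dg_12 w (bilin dg_11 u v) = bilin dg_12 u (bilin dg_11 v w)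
}.

Section ClassB.
Variables (Q R : comNzRingType) (k : fieldType).
Variables (res : {rmorphism Q -> k}) (pi : {rmorphism Q -> R}).

(* k is the residue field of the local ring Q via res, and R is a quotient of
   Q via pi, with the same embedding dimension. *)
Definition presentation : Prop :=
  [/\ local_ring Q,
      (forall a : k, exists q, res q = a) /\
        (forall q, res q = 0 <-> maxideal q),
      forall a : R, exists q, pi q = a
    & exists e, embdim Q e /\ embdim R e].

(* Since F is minimal, F (x)_Q k has zero differential, so A = H(F (x)_Q k) has
   A_i = k^(r_i), with multiplication tables the images under res of those
   of F. *)
Definition tor_11 r1 r2 r3 (F : dg_resolution pi r1 r2 r3) :
    'rV[k]_r1 -> 'rV[k]_r1 -> 'rV[k]_r2 :=
  bilin (fun i j => map_mx res (dg_11 F i j)).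

Definition tor_12 r1 r2 r3 (F : dg_resolution pi r1 r2 r3) :
    'rV[k]_r1 -> 'rV[k]_r2 -> 'rV[k]_r3 :=
  bilin (fun i j => map_mx res (dg_12 F i j)).

(* Class B for R = Q/I, where Q is to be a complete regular local ring.
   Indices start at 0: e`_0, e`_1, ... are the e_1, e_2, ... of the usual
   notation, and likewise for f and g. *)
Definition class_B : Prop :=
  presentation /\ embcodepth R 3 /\
  exists (r1 r2 r3 : nat) (F : dg_resolution pi r1 r2 r3)
    (e : r1.-tuple 'rV[k]_r1) (f : r2.-tuple 'rV[k]_r2)
    (g : r3.-tuple 'rV[k]_r3),
  [/\ [/\ basis_of fullv e, basis_of fullv f & basis_of fullv g],
      [/\ (2 <= r1)%N, (3 <= r2)%N & (1 <= r3)%N],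
      [/\ tor_11 F e`_0 e`_1 = f`_2,
          tor_12 F e`_0 f`_0 = g`_0
        & tor_12 F e`_1 f`_1 = g`_0],
      forall i j, (i < j < r1)%N -> (i, j) != (0, 1)%N ->
        tor_11 F e`_i e`_j = 0
    & forall i j, (i < r1)%N -> (j < r2)%N ->
        (i, j) != (0, 0)%N -> (i, j) != (1, 1)%N ->
        tor_12 F e`_i f`_j = 0].

End ClassB.


(* f a b c is the coefficient of x^a y^b z^c. *)
Definition pseries3 (k : fieldType) : Type := nat -> nat -> nat -> k.

Section PowerSeries.
Variable k : fieldType.
Local Notation Q := (pseries3 k).
Implicit Types f g h : Q.

HB.instance Definition _ := gen_eqMixin Q.
HB.instance Definition _ := gen_choiceMixin Q.

Definition ps_mono (a b c : nat) : Q :=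
  fun a' b' c' => ((a' == a) && (b' == b) && (c' == c))%:R.

Definition ps_zero : Q := fun _ _ _ => 0.
Definition ps_opp f : Q := fun a b c => - f a b c.
Definition ps_add f g : Q := fun a b c => f a b c + g a b c.
Definition ps_mul f g : Q := fun a b c =>
  \sum_(i < a.+1) \sum_(j < b.+1) \sum_(l < c.+1)
    f i j l * g (a - i)%N (b - j)%N (c - l)%N.

Lemma ps_ext f g : (forall a b c, f a b c = g a b c) -> f = g.
Proof.
by move=> E; apply/funext => a; apply/funext => b; apply/funext => c; apply: E.
Qed.

Fact ps_addA : associative ps_add.
Proof. by move=> f g h; apply: ps_ext => a b c; apply: addrA. Qed.
Fact ps_addC : commutative ps_add.
Proof. by move=> f g; apply: ps_ext => a b c; apply: addrC. Qed.
Fact ps_add0 : left_id ps_zero ps_add.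
Proof. by move=> f; apply: ps_ext => a b c; apply: add0r. Qed.
Fact ps_addN : left_inverse ps_zero ps_opp ps_add.
Proof. by move=> f; apply: ps_ext => a b c; apply: addNr. Qed.

HB.instance Definition _ :=
  GRing.isZmodule.Build Q ps_addA ps_addC ps_add0 ps_addN.

(* The ring axioms are transported from iterated polynomials: P approximates f
   when they have the same coefficients up to a given multidegree. *)
Let approx (N : nat * nat * nat) (P : {poly {poly {poly k}}}) f :=
  forall i j l, (i <= N.1.1)%N -> (j <= N.1.2)%N -> (l <= N.2)%N ->
    P`_i`_j`_l = f i j l.

Let trunc (N : nat * nat * nat) f : {poly {poly {poly k}}} :=
  \poly_(i < N.1.1.+1) \poly_(j < N.1.2.+1) \poly_(l < N.2.+1) f i j l.

Let truncP N f : approx N (trunc N f) f.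
Proof.
move=> i j l li lj ll.
by rewrite coef_poly ltnS li coef_poly ltnS lj coef_poly ltnS ll.
Qed.

Let approxM N P P' f g :
  approx N P f -> approx N P' g -> approx N (P * P') (ps_mul f g).
Proof.
move=> Pf Pg i j l le_i le_j le_l; rewrite coefM !coef_sum /ps_mul.
apply: eq_bigr => i' _; rewrite coefM coef_sum.
apply: eq_bigr => j' _; rewrite coefM.
have le_ord n m (u : 'I_n.+1) : (n <= m)%N -> (u <= m)%N.
  by apply: leq_trans; rewrite -ltnS ltn_ord.
have le_sub n m u : (n <= m)%N -> (n - u <= m)%N.
  by apply: leq_trans; apply: leq_subr.
apply: eq_bigr => l' _.
by rewrite Pf ?(le_ord _ _ _ le_i) ?(le_ord _ _ _ le_j) ?(le_ord _ _ _ le_l) //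
   Pg ?le_sub.
Qed.

Let approx_eq P f g : (forall N, approx N (P N) f) ->
  (forall N, approx N (P N) g) -> f = g.
Proof.
move=> Pf Pg; apply: ps_ext => a b c.
by rewrite -(Pf (a, b, c)) // -(Pg (a, b, c)).
Qed.

Fact ps_mulA : associative ps_mul.
Proof.
move=> f g h.
apply: (@approx_eq (fun N => trunc N f * (trunc N g * trunc N h))) => N.
  by do 2?apply: approxM => //; apply: truncP.
by rewrite mulrA; do 2?apply: approxM => //; apply: truncP.
Qed.

Fact ps_mulC : commutative ps_mul.
Proof.
move=> f g; apply: (@approx_eq (fun N => trunc N f * trunc N g)) => N.
  by apply: approxM; apply: truncP.
by rewrite mulrC; apply: approxM; apply: truncP.
Qed.

Fact ps_mul1 : left_id (ps_mono 0 0 0) ps_mul.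
Proof.
move=> f; apply: (@approx_eq (fun N => 1 * trunc N f)) => N.
  apply: approxM; last exact: truncP.
  move=> i j l _ _ _; rewrite coef1 /ps_mono.
  case: i => [|i]; rewrite ?coef0 //= coef1.
  by case: j => [|j]; rewrite ?coef0 //= coef1.
by rewrite mul1r; apply: truncP.
Qed.

Fact ps_mulD : left_distributive ps_mul +%R.
Proof.
move=> f g h.
apply: (@approx_eq (fun N => (trunc N f + trunc N g) * trunc N h)) => N.
  apply: approxM; last exact: truncP.
  move=> i j l li lj ll; by rewrite !coefD !(@truncP N _ i j l).
rewrite mulrDl => i j l li lj ll; rewrite !coefD.
by rewrite !(approxM (@truncP N _) (@truncP N _) li lj ll).
Qed.

Fact ps_one_neq0 : ps_mono 0 0 0 != 0.
Proof.
apply/eqP => /(congr1 (fun f : Q => f 0%N 0%N 0%N)) /eqP.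
by rewrite /ps_mono /= oner_eq0.
Qed.

HB.instance Definition _ := GRing.Zmodule_isComNzRing.Build Q
  ps_mulA ps_mulC ps_mul1 ps_mulD ps_one_neq0.

(* The constant term, i.e. the map from k[[x, y, z]] to its residue field. *)
Definition ps_const f : k := f 0%N 0%N 0%N.

Fact ps_const_zmod : zmod_morphism ps_const.
Proof. by []. Qed.
Fact ps_const_monoid : monoid_morphism ps_const.
Proof. by split=> // f g; rewrite /ps_const /GRing.mul /= /ps_mul !big_ord1. Qed.

HB.instance Definition _ :=
  GRing.isZmodMorphism.Build Q k ps_const ps_const_zmod.
HB.instance Definition _ :=
  GRing.isMonoidMorphism.Build Q k ps_const ps_const_monoid.


Local Notation x := (ps_mono 1 0 0 : Q).
Local Notation y := (ps_mono 0 1 0 : Q).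
Local Notation z := (ps_mono 0 0 1 : Q).

Definition b1_gens : seq Q := [:: x ^+ 3; x ^+ 2 * y; y * z ^+ 2; z ^+ 3].
Definition b2_gens : seq Q := b1_gens ++ [:: x * y * z].
Definition b3_gens : seq Q := b2_gens ++ [:: x * y ^+ 2 - y ^+ 3].
Definition b4_gens : seq Q := b3_gens ++ [:: y ^+ 2 * z].

(* Meaningful for 1 <= n <= 4. *)
Definition b_gens (n : nat) : seq Q :=
  match n with
  | 0 | 1 => b1_gens
  | 2 => b2_gens
  | 3 => b3_gens
  | _ => b4_gens
  end.

Definition b_pred (n : nat) : Q -> bool := gen_ideal (b_gens n).

Lemma b_gens_const n : all (fun f => ps_const f == 0) (b_gens n).
Proof.
have x0 : ps_const x = 0 by [].
have y0 : ps_const y = 0 by [].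
have z0 : ps_const z = 0 by [].
by case: n => [|[|[|[|n]]]] /=;
  rewrite ?rmorphB ?rmorphM ?rmorphXn /= ?x0 ?y0 ?z0 ?expr0n /= ?mul0r ?mulr0
    ?subrr ?eqxx.
Qed.

Fact b_pred_closed n : idealr_closed (b_pred n).
Proof.
split.
- apply/asboolP; exists (fun _ => 0).
  by rewrite big1 // => i _; rewrite mul0r.
- apply/negP => /asboolP [c /(congr1 ps_const) /eqP].
  rewrite rmorph1 rmorph_sum big1 ?oner_eq0 // => i _.
  have /(allP (b_gens_const n)) /eqP g0 : (b_gens n)`_i \in b_gens n.
    by apply: mem_nth; apply: ltn_ord.
  by rewrite rmorphM [X in _ * X]g0 mulr0.
- move=> a u v /asboolP [c ->] /asboolP [c' ->]; apply/asboolP.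
  exists (fun i => a * c i + c' i); rewrite mulr_sumr -big_split /=.
  by apply: eq_bigr => i _; rewrite mulrDl mulrA.
Qed.

HB.instance Definition _ n := isIdealr.Build Q (b_pred n) (b_pred_closed n).

Definition b_ideal (n : nat) : idealr Q := b_pred n.

Definition b_quot (n : nat) : comNzRingType := {ideal_quot (b_ideal n)}.

Definition b_proj (n : nat) : {rmorphism Q -> b_quot n} :=
  (\pi_({ideal_quot (b_ideal n)}))%qT.

End PowerSeries.

(* Main.v *)
Require Import Defs.
From mathcomp Require Import all_boot all_algebra.
From mathcomp Require Import boolp ring.

(** For each of the four ideals b we exhibit a complex F of free Q-modules,
    defined over Z[x,y,z], together with multiplication tables satisfying the
    Leibniz rule; these are finitely many polynomial identities.  By the Leibniz
    rule, multiplication by d_1(u) is null-homotopic on F, the homotopy being the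
    left multiplication by u.  Hence b annihilates the homology of F in positive
    degrees, and F is exact as soon as b contains a regular sequence of length 3,
    such as x^3, z^3, y^4 for b_3 and b_4.  The ideals b_1 and b_2 have grade 2
    only, which still gives exactness in degrees 2 and 3; in degree 1 the missing
    element is y, which annihilates the homology by a direct computation with
    syzygies.  The remaining DG algebra axioms follow from the injectivity of d_3,
    and the multiplication of A is read off from the constant terms of the tables.

    The socle of Q/b is H_3(K (x) Q/b) = Tor_3(k, Q/b) for the Koszul complex K on
    x, y, z, so that its rank is the rank of F_3.  As the socle is not zero, Q/b
    has depth 0, and the rank of F_3 is its type. *)

Set Implicit Arguments.
Unset Strict Implicit.
Unset Printing Implicit Defensive.

Import GRing.Theory.
Local Open Scope ring_scope.

(** * Regular sequences and exactness of complexes with homotopies *)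

Section MatrixEntries.
Variables (R : comNzRingType) (m n : nat).
Implicit Types A B : 'M[R]_(m, n).

Lemma addmxE A B i j : (A + B) i j = A i j + B i j.
Proof. by rewrite mxE. Qed.
Lemma oppmxE A i j : (- A) i j = - A i j.
Proof. by rewrite mxE. Qed.
Lemma scalemxE a A i j : (a *: A) i j = a * A i j.
Proof. by rewrite mxE. Qed.
Lemma zeromxE i j : (0 : 'M[R]_(m, n)) i j = 0.
Proof. by rewrite mxE. Qed.

End MatrixEntries.

Definition lincombE := (addmxE, oppmxE, scalemxE, zeromxE).

(* Leaves products of matrices alone, so that they become atoms for [ring]. *)
Ltac mxring := apply/matrixP => ? ?; rewrite !lincombE; ring.

Section RegularTriples.
Variable Q : comNzRingType.

(** Weak regularity of the sequence s, t, r; ideal membership is spelled out by witnesses, so that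
    it passes entrywise to matrices. *)
Definition regular_triple (s t r : Q) : Prop :=
  [/\ forall a, s * a = 0 -> a = 0,
      forall a b, t * a = s * b -> exists c, a = s * c
    & forall a b c, r * a = s * b + t * c ->
        exists b' c', a = s * b' + t * c'].

Variables (s t r : Q).
Hypothesis str : regular_triple s t r.
Variables m n : nat.
Implicit Types A B C : 'M[Q]_(m, n).

Lemma regular_scalemx_inj A B : s *: A = s *: B -> A = B.
Proof.
case: str => reg _ _ eqAB; apply/matrixP => i j; apply/eqP; rewrite -subr_eq0.
apply/eqP/reg; rewrite mulrBr; apply/eqP; rewrite subr_eq0; apply/eqP.
by move/matrixP/(_ i j): eqAB; rewrite !lincombE.
Qed.

Lemma regular_scalemx_div A B : t *: A = s *: B -> exists C, A = s *: C.
Proof.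
case: str => _ reg _ eqAB.
have /choice [c cP] : forall ij : 'I_m * 'I_n, exists c, A ij.1 ij.2 = s * c.
  case=> i j; apply: (reg _ (B i j)).
  by move/matrixP/(_ i j): eqAB; rewrite !lincombE.
exists (\matrix_(i, j) c (i, j)); apply/matrixP => i j.
by rewrite lincombE mxE -cP.
Qed.

Lemma regular_scalemx_div2 A B C :
  r *: A = s *: B + t *: C -> exists B' C', A = s *: B' + t *: C'.
Proof.
case: str => _ _ reg eqABC.
have /choice [c cP] :
    forall ij : 'I_m * 'I_n, exists c, A ij.1 ij.2 = s * c.1 + t * c.2.
  case=> i j; have [b' [c' E]] : exists b' c', A i j = s * b' + t * c'.
    apply: (reg _ (B i j) (C i j)).
    by move/matrixP/(_ i j): eqABC; rewrite !lincombE.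
  by exists (b', c').
exists (\matrix_(i, j) (c (i, j)).1), (\matrix_(i, j) (c (i, j)).2).
by apply/matrixP => i j; rewrite !lincombE !mxE -cP.
Qed.

(** Exactness at K_2 of the Koszul complex on s, t, r with free coefficients: regularity of t
    divides U1 by s, and cancelling s gives U2 and U3. *)
Lemma koszul_exact2 (U1 U2 U3 : 'M[Q]_(m, n)) :
  s *: U2 = t *: U1 -> s *: U3 = r *: U1 ->
  exists f, [/\ U1 = s *: f, U2 = t *: f & U3 = r *: f].
Proof.
move=> E2 E3; have [f Ef] := regular_scalemx_div (esym E2).
exists f; split=> //; apply: regular_scalemx_inj.
  by rewrite E2 Ef !scalerA mulrC.
by rewrite E3 Ef !scalerA mulrC.
Qed.

(** Exactness at K_1: regularity of r modulo (s, t) splits c, which leaves a relation between s and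
    t alone; that relation produces u3. *)
Lemma koszul_exact1 (a b c : 'M[Q]_(m, n)) :
  s *: a - t *: b + r *: c = 0 ->
  exists u1 u2 u3, [/\ a = t *: u3 - r *: u2, b = s *: u3 - r *: u1
                     & c = s *: u2 - t *: u1].
Proof.
move=> E; have Ec : r *: c = s *: (- a) + t *: b.
  by apply: (addrI (s *: a - t *: b)); rewrite E; mxring.
have [u2 [u1' Eu]] := regular_scalemx_div2 Ec; pose u1 := - u1'.
have Eb : t *: (b + r *: u1) = s *: (a + r *: u2).
  apply/eqP; rewrite -subr_eq0 -oppr_eq0 -E Eu /u1; apply/eqP; mxring.
have [u3 E3] := regular_scalemx_div Eb.
exists u1, u2, u3; split.
- apply: (addIr (r *: u2)); rewrite subrK.
  by apply: regular_scalemx_inj; rewrite -Eb E3 !scalerA mulrC.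
- by rewrite -E3 addrK.
- by rewrite Eu /u1; mxring.
Qed.

End RegularTriples.

(** The sum on the right is the matrix of left multiplication by u; through it the axioms on [bilin]
    become matrix identities. *)
Lemma bilin_rows (S : comNzRingType) p q r (C : 'I_p -> 'M[S]_(q, r))
    (u : 'rV_p) (v : 'rV_q) :
  bilin (fun i j => row j (C i)) u v = v *m (\sum_i u 0 i *: C i).
Proof.
rewrite /bilin mulmx_sumr; apply: eq_bigr => i _.
rewrite -scalemxAr mulmx_sum_row scaler_sumr; apply: eq_bigr => j _.
by rewrite scalerA.
Qed.

(** Terms off the diagonal cancel in pairs, without a division by 2, so characteristic 2 is
    covered. *)
Lemma sum_alternating (V : zmodType) n (T : 'I_n -> 'I_n -> V) :
    (forall i, T i i = 0) -> (forall i j, T i j = - T j i) ->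
  \sum_i \sum_j T i j = 0.
Proof.
move=> Tii Tij; rewrite pair_bigA /=.
rewrite (bigID (fun p : 'I_n * 'I_n => p.1 < p.2)%N) /= addrC.
rewrite (bigID (fun p : 'I_n * 'I_n => p.1 == p.2)) /= big1 ?add0r; last first.
  by move=> [i j] /= /andP[_ /eqP->].
rewrite (reindex_inj (h := fun p : 'I_n * 'I_n => (p.2, p.1))) /=; last first.
  by move=> [? ?] [? ?] [-> ->].
rewrite (eq_bigl (fun p : 'I_n * 'I_n => p.1 < p.2)%N) => [|[i j]] /=; last first.
  by rewrite -leqNgt ltn_neqAle eq_sym andbC.
by rewrite -big_split big1 // => -[i j] _ /=; rewrite Tij addNr.
Qed.

(* A complex F of length 3, with for each basis element e_i of F_1 a homotopy
   (A i, B i) for the multiplication by d_1(e_i): in a DG algebra structure,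
   left multiplication by e_i is such a homotopy by the Leibniz rule. *)
Section Homotopies.
Variables (Q R : comNzRingType) (pi : {rmorphism Q -> R}) (r1 r2 r3 : nat).
Variables (d1 : 'M[Q]_(r1, 1)) (d2 : 'M[Q]_(r2, r1)) (d3 : 'M[Q]_(r3, r2)).
Variables (A : 'I_r1 -> 'M[Q]_(r1, r2)) (B : 'I_r1 -> 'M[Q]_(r2, r3)).
Hypothesis d21 : d2 *m d1 = 0.
Hypothesis d32 : d3 *m d2 = 0.
Hypothesis A_diag : forall i, row i (A i) = 0.
Hypothesis A_anti : forall i j, row j (A i) = - row i (A j).
Hypothesis homotopy1 : forall i,
  A i *m d2 + d1 *m delta_mx 0 i = (d1 i 0)%:M.
Hypothesis homotopy2 : forall i, B i *m d3 + d2 *m A i = (d1 i 0)%:M.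
Hypothesis homotopy3 : forall i, d3 *m B i = (d1 i 0)%:M.

Definition mul1 (u : 'rV[Q]_r1) : 'M[Q]_(r1, r2) := \sum_i u 0 i *: A i.
Definition mul2 (u : 'rV[Q]_r1) : 'M[Q]_(r2, r3) := \sum_i u 0 i *: B i.
Definition aug (u : 'rV[Q]_r1) : Q := (u *m d1) 0 0.

Lemma mulmx_d1E (u : 'rV[Q]_r1) : u *m d1 = (aug u)%:M.
Proof. exact: mx11_scalar. Qed.

Lemma augE u : aug u = \sum_i u 0 i * d1 i 0.
Proof. by rewrite /aug mxE. Qed.

Lemma mul1_homotopy u : mul1 u *m d2 + d1 *m u = (aug u)%:M.
Proof.
rewrite augE [RHS]raddf_sum /= [X in d1 *m X]row_sum_delta mulmx_suml mulmx_sumr.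
rewrite -big_split /=; apply: eq_bigr => i _.
by rewrite -scalemxAl -scalemxAr -scalerDr homotopy1 scale_scalar_mx.
Qed.

Lemma mul2_homotopy u : mul2 u *m d3 + d2 *m mul1 u = (aug u)%:M.
Proof.
rewrite augE [RHS]raddf_sum /= mulmx_suml /mul1 mulmx_sumr -big_split /=.
apply: eq_bigr => i _.
by rewrite -scalemxAl -scalemxAr -scalerDr homotopy2 scale_scalar_mx.
Qed.

Lemma mul3_homotopy u : d3 *m mul2 u = (aug u)%:M.
Proof.
rewrite augE [RHS]raddf_sum /= /mul2 mulmx_sumr; apply: eq_bigr => i _.
by rewrite -scalemxAr homotopy3 scale_scalar_mx.
Qed.

Lemma homotopy_cycle1 u (v : 'rV_r1) :
  v *m d1 = 0 -> v *m mul1 u *m d2 = aug u *: v.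
Proof.
move=> v0; have := congr1 (mulmx v) (mul1_homotopy u).
by rewrite mulmxDr !mulmxA v0 mul0mx addr0 mul_mx_scalar.
Qed.

Lemma homotopy_cycle2 u (v : 'rV_r2) :
  v *m d2 = 0 -> v *m mul2 u *m d3 = aug u *: v.
Proof.
move=> v0; have := congr1 (mulmx v) (mul2_homotopy u).
by rewrite mulmxDr !mulmxA v0 mul0mx addr0 mul_mx_scalar.
Qed.

Variables (u1 u2 : 'rV[Q]_r1) (r : Q).
Hypothesis reg : regular_triple (aug u1) (aug u2) r.

Lemma homotopy_exact3 (v : 'rV_r3) : v *m d3 = 0 -> v = 0.
Proof.
move=> v0; apply: (regular_scalemx_inj reg).
by rewrite scaler0 -mul_mx_scalar -mul3_homotopy mulmxA v0 mul0mx.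
Qed.

Lemma mulmx_d3_inj (v w : 'rV_r3) : v *m d3 = w *m d3 -> v = w.
Proof.
move=> E; apply/eqP; rewrite -subr_eq0; apply/eqP/homotopy_exact3.
by rewrite mulmxBl E subrr.
Qed.

(** With s, t the two augmentations, the homotopies give preimages of s v and t v. Injectivity of d3
    makes them proportional, and division by s yields a preimage of v. *)
Lemma homotopy_exact2 (v : 'rV_r2) :
  v *m d2 = 0 <-> exists w : 'rV_r3, v = w *m d3.
Proof.
split=> [v0|[w ->]]; last by rewrite -mulmxA d32 mulmx0.
have E : aug u2 *: (v *m mul2 u1) = aug u1 *: (v *m mul2 u2).
  apply: mulmx_d3_inj; rewrite -!scalemxAl !homotopy_cycle2 // !scalerA.
  by rewrite mulrC.
have [c Ec] := regular_scalemx_div reg E; exists c.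
apply: (regular_scalemx_inj reg).
by rewrite -homotopy_cycle2 // Ec -scalemxAl.
Qed.

Hypothesis r_kills_homology1 : forall v : 'rV[Q]_r1,
  v *m d1 = 0 -> exists w : 'rV_r2, w *m d2 = r *: v.

(** The preimages w1, w2, w3 of s v, t v, r v need not be proportional, but their cross differences
    come from q12, q13, q23 in F_3, which satisfy a Koszul relation. Regularity of r splits q12 over
    (s, t), and this corrects w1 and w2. Of r only the annihilation of homology is assumed, since y
    lies neither in b_1 nor in b_2. *)
Lemma homotopy_exact1 (v : 'rV_r1) :
  v *m d1 = 0 <-> exists w : 'rV_r2, v = w *m d2.
Proof.
split=> [v0|[w ->]]; last by rewrite -mulmxA d21 mulmx0.
have E1 := homotopy_cycle1 u1 v0; have E2 := homotopy_cycle1 u2 v0.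
have [w3 E3] := r_kills_homology1 v0.
move: (v *m mul1 u1) (v *m mul1 u2) E1 E2 => w1 w2 E1 E2.
move: reg; move: (aug u1) (aug u2) E1 E2 => s t E1 E2 str.
have cyc (w w' : 'rV_r2) (a b : Q) : w *m d2 = a *: v -> w' *m d2 = b *: v ->
    exists q : 'rV_r3, a *: w' - b *: w = q *m d3.
  move=> Ew Ew'; apply/homotopy_exact2.
  by rewrite mulmxBl -!scalemxAl Ew Ew' !scalerA mulrC subrr.
have [q12 E12] := cyc _ _ _ _ E1 E2.
have [q13 E13] := cyc _ _ _ _ E1 E3.
have [q23 E23] := cyc _ _ _ _ E2 E3.
have Eq : r *: q12 = s *: (- q23) + t *: q13.
  apply: mulmx_d3_inj; rewrite mulmxDl -!scalemxAl mulNmx -E12 -E13 -E23.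
  by mxring.
have [b [c Ebc]] := regular_scalemx_div2 str Eq.
have E : t *: (w1 + c *m d3) = s *: (w2 - b *m d3).
  have := E12; rewrite Ebc mulmxDl -!scalemxAl => /eqP.
  rewrite -subr_eq0 => /eqP E0.
  by apply/eqP; rewrite -subr_eq0 -oppr_eq0 -E0; apply/eqP; mxring.
have [w Ew] := regular_scalemx_div str E; exists w.
apply: (regular_scalemx_inj str); rewrite scalemxAl -Ew mulmxDl E1.
by rewrite -mulmxA d32 mulmx0 addr0.
Qed.

Lemma mul1_alternating u : u *m mul1 u = 0.
Proof.
rewrite /mul1 -bilin_rows; apply: sum_alternating => [i|i j].
  by rewrite A_diag scaler0.
by rewrite A_anti scalerN mulrC.
Qed.

Lemma mul1_anticomm u v : v *m mul1 u = - (u *m mul1 v).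
Proof.
rewrite /mul1 -!bilin_rows /bilin exchange_big /= -sumrN.
apply: eq_bigr => i _; rewrite -sumrN; apply: eq_bigr => j _.
by rewrite A_anti scalerN mulrC.
Qed.

Hypothesis exact0 : forall q : Q,
  pi q = 0 <-> exists v : 'rV_r1, (v *m d1) 0 0 = q.
Hypothesis minimal1 : forall i j, maxideal (d1 i j).
Hypothesis minimal2 : forall i j, maxideal (d2 i j).
Hypothesis minimal3 : forall i j, maxideal (d3 i j).

Lemma homotopy_dg_resolution : exists F : dg_resolution pi r1 r2 r3,
  [/\ dg_d1 F = d1, dg_d2 F = d2 & dg_d3 F = d3] /\
  [/\ dg_11 F = (fun i j => row j (A i)) & dg_12 F = (fun i j => row j (B i))].
Proof.
have leib13 u (g : 'rV_r3) : g *m d3 *m mul2 u = aug u *: g.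
  by rewrite -mulmxA mul3_homotopy mul_mx_scalar.
have leib12 u (f : 'rV_r2) :
    f *m mul2 u *m d3 = aug u *: f - f *m d2 *m mul1 u.
  by rewrite -mul_mx_scalar -mul2_homotopy mulmxDr !mulmxA addrK.
have leib11 u v : v *m mul1 u *m d2 = aug u *: v - aug v *: u.
  rewrite -mul_mx_scalar -mul1_homotopy mulmxDr !mulmxA mulmx_d1E.
  by rewrite mul_scalar_mx addrK.
unshelve eexists; [apply: (@DGResolution _ _ pi r1 r2 r3 d1 d2 d3
  (fun i j => row j (A i)) (fun i j => row j (B i))) => // | by []].
- exact: homotopy_exact1.
- exact: homotopy_exact2.
- exact: homotopy_exact3.
- by move=> u; rewrite bilin_rows; apply: mul1_alternating.
- by move=> u v; rewrite bilin_rows; apply: leib11.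
- by move=> u f; rewrite !bilin_rows; apply: leib12.
- move=> u g; rewrite bilin_rows; apply/eqP; rewrite subr_eq0 eq_sym.
  exact/eqP/leib13.
(* After d3, each summand becomes, up to sign, the product of the boundaries of f and f'; the two
   cancel by anticommutativity. *)
- move=> f f'; rewrite !bilin_rows -/(mul2 _) -/(mul2 _).
  apply: mulmx_d3_inj; rewrite mul0mx mulmxDl !leib12 {1}mul1_anticomm.
  by rewrite /aug -!mulmxA d21 !mulmx0 zeromxE !scale0r !sub0r opprK subrr.
(* Under d3 the Leibniz rule turns both sides into the same combination of pairwise products of u,
   v, w. *)
- move=> u v w; rewrite !bilin_rows -/(mul2 _) -/(mul2 _) -/(mul1 _) -/(mul1 _).
  apply: mulmx_d3_inj; rewrite !leib12 !leib11 !mulmxBl -!scalemxAl.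
  rewrite (mul1_anticomm v w) (mul1_anticomm u w) (mul1_anticomm u v).
  mxring.
Qed.

End Homotopies.

(** * The socle and the last module of a minimal resolution *)

(* The socle of R is H_3 of R (x) K, for K the Koszul complex on x1, x2, x3; it
   is compared with F_3 (x) k = H_3(F (x) k) through the double complex
   F (x) K, in which [zigzag] describes the connecting relation. *)
Section SocleRank.
Variables (Q R : comNzRingType) (pi : {rmorphism Q -> R}) (r1 r2 r3 : nat).
Variable F : dg_resolution pi r1 r2 r3.
Variables x1 x2 x3 : Q.
Hypothesis regx : regular_triple x1 x2 x3.
Hypothesis maxidealP : forall q : Q,
  maxideal q <-> exists a b c, q = x1 * a + x2 * b + x3 * c.
Hypothesis pi_surj : forall a : R, exists q, pi q = a.
Hypothesis pi_maxideal : forall q, maxideal (pi q) <-> maxideal q.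

Local Notation d1 := (dg_d1 F).
Local Notation d2 := (dg_d2 F).
Local Notation d3 := (dg_d3 F).

Lemma mulmx_d21 (w : 'rV_r2) : w *m d2 *m d1 = 0.
Proof. by apply/(dg_exact1 F); exists w. Qed.

Lemma mulmx_d32 (w : 'rV_r3) : w *m d3 *m d2 = 0.
Proof. by apply/(dg_exact2 F); exists w. Qed.

Lemma dg_d3_inj (v w : 'rV_r3) : v *m d3 = w *m d3 -> v = w.
Proof.
move=> E; apply/eqP; rewrite -subr_eq0; apply/eqP; apply: (@dg_exact3 _ _ _ _ _ _ F).
by rewrite mulmxBl E subrr.
Qed.

Lemma maxideal_row n (v : 'rV[Q]_n) : (forall i, maxideal (v 0 i)) <->
  exists a b c, v = x1 *: a + x2 *: b + x3 *: c.
Proof.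
split=> [vm|[a [b [c ->]]] i]; last first.
  by apply/maxidealP; exists (a 0 i), (b 0 i), (c 0 i); rewrite !lincombE.
have /choice [c cP] : forall i, exists c,
    v 0 i = x1 * c.1.1 + x2 * c.1.2 + x3 * c.2.
  by move=> i; have /maxidealP [a [b [c ->]]] := vm i; exists (a, b, c).
exists (\row_i (c i).1.1), (\row_i (c i).1.2), (\row_i (c i).2).
by apply/rowP => i; rewrite !lincombE !mxE cP.
Qed.

(** Here f lies in F_0 (x) K_3, the u in F_1 (x) K_2, the p in F_2 (x) K_1 and q in F_3 (x) K_0. The
    Koszul differential of each equals the image of the next under the differential of F. *)
Definition zigzag (f : 'rV[Q]_1) (q : 'rV[Q]_r3) : Prop :=
  exists (u1 u2 u3 : 'rV[Q]_r1) (p12 p13 p23 : 'rV[Q]_r2),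
  [/\ [/\ x1 *: f = u1 *m d1, x2 *: f = u2 *m d1 & x3 *: f = u3 *m d1],
      [/\ x1 *: u2 - x2 *: u1 = p12 *m d2, x1 *: u3 - x3 *: u1 = p13 *m d2
        & x2 *: u3 - x3 *: u2 = p23 *m d2]
    & x1 *: p23 - x2 *: p13 + x3 *: p12 = q *m d3].

Lemma zigzagZD a f f' q q' :
  zigzag f q -> zigzag f' q' -> zigzag (a *: f + f') (a *: q + q').
Proof.
move=> [u1 [u2 [u3 [p12 [p13 [p23 [[E1 E2 E3] [E12 E13 E23] E]]]]]]].
move=> [u1' [u2' [u3' [p12' [p13' [p23' [[F1 F2 F3] [F12 F13 F23] F']]]]]]].
exists (a *: u1 + u1'), (a *: u2 + u2'), (a *: u3 + u3').
exists (a *: p12 + p12'), (a *: p13 + p13'), (a *: p23 + p23').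
rewrite !mulmxDl -!scalemxAl -E1 -E2 -E3 -E12 -E13 -E23 -E.
by rewrite -F1 -F2 -F3 -F12 -F13 -F23 -F'; do !split; mxring.
Qed.

Lemma zigzag0 : zigzag 0 0.
Proof.
exists 0, 0, 0, 0, 0, 0.
by rewrite !mul0mx; do !split; mxring.
Qed.

Lemma zigzag_sum n (a : 'I_n -> Q) f q :
    (forall i, zigzag (f i) (q i)) ->
  zigzag (\sum_i a i *: f i) (\sum_i a i *: q i).
Proof.
move=> fq; apply: (big_ind2 zigzag) => [|g r g' r' gr gr'|i _].
- exact: zigzag0.
- by rewrite -(scale1r g) -(scale1r r); apply: zigzagZD.
- by rewrite -[_ *: f i]addr0 -[_ *: q i]addr0; apply/zigzagZD/zigzag0.
Qed.

Definition in_ideal (f : 'rV[Q]_1) := exists v : 'rV[Q]_r1, f = v *m d1.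

Lemma in_idealE f : in_ideal f <-> pi (f 0 0) = 0.
Proof.
rewrite (dg_exact0 F); split=> [[v ->]|[v E]]; exists v => //.
by apply/rowP => i; rewrite !ord1 E.
Qed.

(** The chase from K_3 to F_3: exactness of F at F_1 gives the p, exactness at F_2 gives q. *)
Lemma zigzag_total f : in_ideal (x1 *: f) -> in_ideal (x2 *: f) ->
  in_ideal (x3 *: f) -> exists q, zigzag f q.
Proof.
move=> [u1 E1] [u2 E2] [u3 E3].
have syz (s t : Q) (u v : 'rV_r1) : s *: f = u *m d1 -> t *: f = v *m d1 ->
    exists p : 'rV_r2, s *: v - t *: u = p *m d2.
  move=> Eu Ev; apply/(dg_exact1 F).
  by rewrite mulmxBl -!scalemxAl -Eu -Ev; mxring.
have [p12 E12] := syz _ _ _ _ E1 E2.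
have [p13 E13] := syz _ _ _ _ E1 E3.
have [p23 E23] := syz _ _ _ _ E2 E3.
have /(dg_exact2 F) [q Eq] : (x1 *: p23 - x2 *: p13 + x3 *: p12) *m d2 = 0.
  rewrite mulmxDl mulmxBl -!scalemxAl -E12 -E13 -E23.
  by mxring.
by exists q, u1, u2, u3, p12, p13, p23.
Qed.

(** The chase back: minimality of [d3] provides the p, and exactness of the Koszul complex provides
    the u and then f. *)
Lemma zigzag_onto q : exists f, zigzag f q.
Proof.
have /maxideal_row [p23 [p13' [p12 Ep]]] : forall i, maxideal ((q *m d3) 0 i).
  move=> i; have /choice [c cP] : forall j, exists c,
      d3 j i = x1 * c.1.1 + x2 * c.1.2 + x3 * c.2.
    move=> j; have /maxidealP [a [b [c ->]]] := @dg_minimal3 _ _ _ _ _ _ F j i.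
    by exists (a, b, c).
  apply/maxidealP.
  exists (\sum_j q 0 j * (c j).1.1), (\sum_j q 0 j * (c j).1.2).
  exists (\sum_j q 0 j * (c j).2).
  rewrite mxE !mulr_sumr -!big_split /=; apply: eq_bigr => j _.
  by rewrite cP; ring.
(* In the Koszul differential the middle term has a minus sign. *)
pose p13 := - p13'.
have Eq : x1 *: p23 - x2 *: p13 + x3 *: p12 = q *m d3.
  by rewrite Ep /p13; mxring.
have E2 : x1 *: (p23 *m d2) - x2 *: (p13 *m d2) + x3 *: (p12 *m d2) = 0.
  by rewrite !scalemxAl -mulmxBl -mulmxDl Eq mulmx_d32.
have [u1 [u2 [u3 [E23 E13 E12]]]] := koszul_exact1 regx E2.
have syz (s t : Q) (u v : 'rV_r1) (p : 'rV_r2) : p *m d2 = s *: v - t *: u ->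
    s *: (v *m d1) = t *: (u *m d1).
  move=> E; apply/eqP; rewrite -subr_eq0 !scalemxAl -mulmxBl -E.
  by rewrite mulmx_d21.
have [f [F1 F2 F3]] := koszul_exact2 regx (syz _ _ _ _ _ E12) (syz _ _ _ _ _ E13).
by exists f, u1, u2, u3, p12, p13, p23.
Qed.

(** So the relation induces a bijection between the socle and F_3 (x) k. One direction peels Koszul
    boundaries off the u and the p by exactness of F; the other peels boundaries of F off the p and
    the u by exactness of the Koszul complex. *)
Lemma zigzag_max f q : zigzag f q -> in_ideal f <-> forall i, maxideal (q 0 i).
Proof.
move=> [u1 [u2 [u3 [p12 [p13 [p23 [[E1 E2 E3] [E12 E13 E23] Eq]]]]]]].
rewrite maxideal_row; split=> [[w Ew]|[q23 [q13' [q12 E]]]].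
  have bd (s : Q) (u : 'rV_r1) : s *: f = u *m d1 ->
      exists t : 'rV_r2, u = s *: w + t *m d2.
    move=> Eu; have /(dg_exact1 F)[t Et] : (u - s *: w) *m d1 = 0.
      by rewrite mulmxBl -Eu -scalemxAl Ew subrr.
    by exists t; rewrite -Et addrC subrK.
  have [t1 T1] := bd _ _ E1; have [t2 T2] := bd _ _ E2.
  have [t3 T3] := bd _ _ E3.
  have bd2 (s s' : Q) (t t' p : 'rV_r2) :
      s *: (s' *: w + t' *m d2) - s' *: (s *: w + t *m d2) = p *m d2 ->
      exists r : 'rV_r3, p = s *: t' - s' *: t + r *m d3.
    move=> Ep; have /(dg_exact2 F)[r Er] : (p - (s *: t' - s' *: t)) *m d2 = 0.
      by rewrite mulmxBl -Ep mulmxBl -!scalemxAl; mxring.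
    by exists r; rewrite -Er addrC subrK.
  rewrite {}T1 {}T2 {}T3 in E12 E13 E23.
  have [q12 Q12] := bd2 _ _ _ _ _ E12; have [q13 Q13] := bd2 _ _ _ _ _ E13.
  have [q23 Q23] := bd2 _ _ _ _ _ E23.
  exists q23, (- q13), q12; apply: dg_d3_inj.
  by rewrite -Eq Q12 Q13 Q23 !mulmxDl -!scalemxAl mulNmx; mxring.
pose q13 := - q13'.
have {}E : x1 *: (p23 - q23 *m d3) - x2 *: (p13 - q13 *m d3)
    + x3 *: (p12 - q12 *m d3) = 0.
  move: Eq; rewrite E !mulmxDl -!scalemxAl /q13 mulNmx => /eqP.
  by rewrite -subr_eq0 => /eqP <-; mxring.
have [t1 [t2 [t3 [T23 T13 T12]]]] := koszul_exact1 regx E.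
have corr (s s' : Q) (u u' : 'rV_r1) (t t' p : 'rV_r2) (r : 'rV_r3) :
    s *: u' - s' *: u = p *m d2 -> p - r *m d3 = s *: t' - s' *: t ->
    s *: (u' - t' *m d2) = s' *: (u - t *m d2).
  move=> Eu Et; have : (p - r *m d3) *m d2 = s *: u' - s' *: u.
    by rewrite mulmxBl mulmx_d32 subr0.
  rewrite Et mulmxBl -!scalemxAl => /eqP; rewrite -subr_eq0 -oppr_eq0 => /eqP E0.
  by apply/eqP; rewrite -subr_eq0 -E0; apply/eqP; mxring.
have [w [W1 _ _]] := koszul_exact2 regx (corr _ _ _ _ _ _ _ _ E12 T12)
  (corr _ _ _ _ _ _ _ _ E13 T13).
exists w; apply: (regular_scalemx_inj regx).
rewrite E1 scalemxAl -W1 mulmxBl mulmx_d21 subr0 //.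
Qed.

(** * Presentation of the residue field, socle and depth *)

Definition koszul_rank (i : nat) : nat := if i is 0 then 1 else 3.

Definition koszul_d1 : 'cV[R]_3 :=
  \col_i (if i == 0 then pi x1 else if i == 1 then pi x2 else pi x3).

(** Ext^0 sees only the presentation of k by x1, x2, x3; the later differentials are filled with
    0. *)
Definition koszul_diff (i : nat) : 'M[R]_(koszul_rank i.+1, koszul_rank i) :=
  match i with 0 => koszul_d1 | _ => 0 end.

Lemma pi_maxidealP a :
  maxideal a <-> exists b1 b2 b3, a = pi x1 * b1 + pi x2 * b2 + pi x3 * b3.
Proof.
have [q <-] := pi_surj a; rewrite pi_maxideal maxidealP.
split=> [[a1 [a2 [a3 ->]]]|[b1 [b2 [b3 Eq]]]].
  by exists (pi a1), (pi a2), (pi a3); rewrite !rmorphD !rmorphM.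
have [a1 E1] := pi_surj b1; have [a2 E2] := pi_surj b2.
have [a3 E3] := pi_surj b3.
apply/maxidealP/pi_maxideal; rewrite Eq -E1 -E2 -E3 -!rmorphM -!rmorphD.
by apply/pi_maxideal/maxidealP; exists a1, a2, a3.
Qed.

Lemma mulmx_koszul_d1 (w : 'rV_3) : (w *m koszul_d1) 0 0 =
  pi x1 * w 0 0 + pi x2 * w 0 1 + pi x3 * w 0 (inord 2).
Proof.
rewrite mxE (bigD1 0) // (bigD1 1) // (bigD1 (inord 2)) //=; last first.
  by rewrite -!val_eqE /= inordK.
rewrite big1 => [|[[|[|[|i]]] lti] //=]; last by rewrite -!val_eqE /= inordK.
by rewrite !mxE /= -!val_eqE /= inordK //=; ring.
Qed.

Lemma koszul_resolution : residue_resolution 0 koszul_diff 1%:M.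
Proof.
split=> //.
  exists 1%:M; rewrite mulmx1 mxE eqxx => /(_ 1); apply; exact: mulr1.
move=> v; rewrite mulmx1 pi_maxidealP; split.
  move=> [b1 [b2 [b3 E]]].
  exists (\row_i (if i == 0 then b1 else if i == 1 then b2 else b3)).
  apply/rowP => i.
  by rewrite !ord1 E mulmx_koszul_d1 !mxE /= -!val_eqE /= inordK.
move=> [w ->]; exists (w 0 0), (w 0 1), (w 0 (inord 2)).
by rewrite mulmx_koszul_d1.
Qed.

Lemma koszul_cocycleE (f : 'rV[Q]_1) : koszul_d1 *m map_mx pi f = 0 <->
  [/\ in_ideal (x1 *: f), in_ideal (x2 *: f) & in_ideal (x3 *: f)].
Proof.
split=> [E|[/in_idealE E1 /in_idealE E2 /in_idealE E3]].
  split; apply/in_idealE; rewrite scalemxE rmorphM;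
    [move/matrixP: E => /(_ 0 0)|move/matrixP: E => /(_ 1 0)|
     move/matrixP: E => /(_ (inord 2) 0)]; rewrite !mxE big_ord1 !mxE //=.
  by rewrite -!val_eqE /= inordK.
move: E1 E2 E3; rewrite !scalemxE !rmorphM => E1 E2 E3.
apply/matrixP=> i j; rewrite !mxE big_ord1 !mxE !ord1.
by case: ifP => // _; case: ifP.
Qed.

Lemma map_mx_eq0E (f : 'rV[Q]_1) : map_mx pi f = 0 <-> in_ideal f.
Proof.
rewrite in_idealE; split=> [/matrixP/(_ 0 0)|E]; first by rewrite !mxE.
by apply/matrixP => i j; rewrite !ord1 !mxE.
Qed.

Lemma zigzag_in_ideal f q : zigzag f q ->
  [/\ in_ideal (x1 *: f), in_ideal (x2 *: f) & in_ideal (x3 *: f)].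
Proof.
by move=> [u1 [u2 [u3 [_ [_ [_ [[E1 E2 E3] _ _]]]]]]]; split;
  [exists u1 | exists u2 | exists u3].
Qed.

Lemma sum_delta_row n (a : 'I_n -> Q) :
  \sum_i a i *: (delta_mx 0 i : 'rV_n) = \row_i a i.
Proof. by rewrite [RHS]row_sum_delta; apply: eq_bigr => i _; rewrite mxE. Qed.

Lemma map_mx_lincomb n (a : 'I_n -> Q) (f : 'I_n -> 'rV[Q]_1) :
  \sum_i pi (a i) *: map_mx pi (f i) = map_mx pi (\sum_i a i *: f i).
Proof. by rewrite raddf_sum; apply: eq_bigr => i _; rewrite /= map_mxZ. Qed.

Lemma socle_rank : ext_residue_rank R 0 r3.
Proof.
exists koszul_rank, koszul_diff, 1%:M; split; first exact: koszul_resolution.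
(* The socle basis corresponds to the unit vectors of F_3. *)
have /choice [f fP] := fun i : 'I_r3 => zigzag_onto (delta_mx 0 i).
have lin (a : 'I_r3 -> Q) : zigzag (\sum_i a i *: f i) (\row_i a i).
  by rewrite -sum_delta_row; apply: zigzag_sum.
exists (fun i => map_mx pi (f i)); split.
- by move=> i; apply/koszul_cocycleE/zigzag_in_ideal/fP.
- move=> v; have /choice [g gP] := pi_surj.
  have -> : v = map_mx pi (\row_i g (v i 0)) :> 'rV_1.
    by apply/rowP => i; rewrite !mxE gP !ord1.
  move: (\row_i _) => {v}f' /koszul_cocycleE [/zigzag_total/[apply]/[apply] [[q f'q]]].
  exists (fun i => pi (q 0 i)); rewrite map_mx_lincomb -map_mxB.
  apply/map_mx_eq0E.
  (* A difference related to 0 lies in the ideal by [zigzag_max], so q supplies the coordinates of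
     the socle element. *)
  have Z : zigzag (f' - \sum_i q 0 i *: f i) 0.
    rewrite addrC -scaleN1r.
    have -> : 0 = -1 *: (\row_i q 0 i) + q :> 'rV_r3.
      by apply/rowP => i; rewrite !mxE; ring.
    exact: zigzagZD.
  apply/(zigzag_max Z) => i; rewrite zeromxE; apply/maxidealP.
  by exists 0, 0, 0; rewrite !mulr0 !addr0.
- move=> a; have /choice [b bP] := fun i => pi_surj (a i).
  have -> : \sum_i a i *: map_mx pi (f i) = map_mx pi (\sum_i b i *: f i).
    by rewrite -map_mx_lincomb; apply: eq_bigr => i _; rewrite bP.
  apply: (iff_trans (map_mx_eq0E _)); apply: (iff_trans (zigzag_max (lin b))).
  split=> bm i.
    by rewrite -bP pi_maxideal; have := bm i; rewrite mxE.
  by rewrite mxE -pi_maxideal bP.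
Qed.

Hypothesis r3_gt0 : (0 < r3)%N.

Lemma depth0 : depth R 0.
Proof.
split; first by exists [::]; split => //; split.
case=> // a s [max_s reg_s]; exfalso.
(* The image of f is a nonzero socle element. The first term a of a regular sequence would kill it,
   and regularity of a would then make it 0. *)
have [f fP] := zigzag_onto (delta_mx 0 (Ordinal r3_gt0)).
have [E1 E2 E3] := zigzag_in_ideal fP.
have f0 : in_ideal f.
  apply/in_idealE.
  have : pi (f 0 0) \in gen_ideal (take 0 (a :: s)).
    apply: reg_s => //=; apply/asboolP; exists (fun=> 0).
    rewrite big_ord0.
    have /pi_maxidealP [b1 [b2 [b3 ->]]] := max_s _ (mem_head a s).
    move/in_idealE: E1; move/in_idealE: E2; move/in_idealE: E3.
    rewrite !scalemxE !rmorphM => E3 E2 E1.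
    rewrite !mulrDl ![_ * _ * pi (f 0 0)]mulrAC E1 E2 E3.
    by rewrite !mul0r !addr0.
  by rewrite take0 => /asboolP [c ->]; rewrite big_ord0.
move/(zigzag_max fP)/(_ (Ordinal r3_gt0)): f0.
by rewrite mxE !eqxx => /(_ 1); apply; rewrite mulr1.
Qed.

Lemma cmtype_rank : cmtype R r3.
Proof. by exists 0%N; split; [exact: depth0 | exact: socle_rank]. Qed.

End SocleRank.

(** * Power series in three variables *)

Section PowerSeries.
Variable k : fieldType.
Local Notation Q := (pseries3 k).
Implicit Types f g h q : Q.

Lemma ps_addE f g i j l : (f + g) i j l = f i j l + g i j l.
Proof. by []. Qed.
Lemma ps_oppE f i j l : (- f) i j l = - f i j l.
Proof. by []. Qed.
Lemma ps_mulE f g i j l : (f * g) i j l =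
  \sum_(i' < i.+1) \sum_(j' < j.+1) \sum_(l' < l.+1)
    f i' j' l' * g (i - i')%N (j - j')%N (l - l')%N.
Proof. by []. Qed.
Lemma ps_sumE (I : Type) (r : seq I) (P : pred I) (F : I -> Q) i j l :
  (\sum_(u <- r | P u) F u) i j l = \sum_(u <- r | P u) F u i j l.
Proof. exact: (big_morph (fun f : Q => f i j l)). Qed.

Lemma sum_ord_delta n a (G : nat -> k) :
  \sum_(i < n.+1) (i == a :> nat)%:R * G i = if (a <= n)%N then G a else 0.
Proof.
case: leqP => [le_an|lt_na].
  rewrite (bigD1 (Ordinal (le_an : (a < n.+1)%N))) //= eqxx mul1r big1 ?addr0 //.
  by move=> i; rewrite -val_eqE /= => /negbTE->; rewrite mul0r.
rewrite big1 // => i _; case: eqP => [ia|_]; last by rewrite mul0r.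
by have := ltn_ord i; rewrite ia ltnNge -ltnS ltnS lt_na.
Qed.

Lemma ps_monoE a b c f i j l : (ps_mono k a b c * f) i j l =
  if [&& a <= i, b <= j & c <= l]%N then f (i - a)%N (j - b)%N (l - c)%N else 0.
Proof.
rewrite ps_mulE /ps_mono.
transitivity (\sum_(i' < i.+1) (i' == a :> nat)%:R * \sum_(j' < j.+1)
    (j' == b :> nat)%:R * \sum_(l' < l.+1)
    (l' == c :> nat)%:R * f (i - i')%N (j - j')%N (l - l')%N).
  apply: eq_bigr => i' _; rewrite mulr_sumr; apply: eq_bigr => j' _.
  rewrite mulrA mulr_sumr; apply: eq_bigr => l' _.
  by rewrite !mulrA -!natrM !mulnb.
rewrite (sum_ord_delta _ _ (fun i' => \sum_(j' < j.+1)
    (j' == b :> nat)%:R * \sum_(l' < l.+1)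
    (l' == c :> nat)%:R * f (i - i')%N (j - j')%N (l - l')%N)).
case: ifP => //= _; rewrite (sum_ord_delta _ _ (fun j' => \sum_(l' < l.+1)
    (l' == c :> nat)%:R * f (i - a)%N (j - j')%N (l - l')%N)).
case: ifP => //= _.
by rewrite (sum_ord_delta _ _ (fun l' => f (i - a)%N (j - b)%N (l - l')%N)).
Qed.

Lemma ps_monoM a b c a' b' c' :
  ps_mono k a b c * ps_mono k a' b' c' = ps_mono k (a + a') (b + b') (c + c').
Proof.
apply: ps_ext => i j l; rewrite ps_monoE /ps_mono.
have E m n p : (m == n + p)%N = (n <= m)%N && (m - n == p)%N.
  case: leqP => [le_nm|lt_mn] /=; first by rewrite -(eqn_add2l n (m - n)) subnKC.
  by apply/eqP => e; move: lt_mn; rewrite e ltnNge leq_addr.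
rewrite !E; case: (a <= i)%N; case: (b <= j)%N; case: (c <= l)%N => //=;
  by rewrite ?andbF.
Qed.

Lemma ps_monoX a b c n : ps_mono k a b c ^+ n = ps_mono k (n * a) (n * b) (n * c).
Proof.
elim: n => [|n IH]; first by rewrite !mul0n expr0.
by rewrite exprS IH ps_monoM !mulSn.
Qed.

(** All quotients are shifts of coefficient functions. In the last clause, a coefficient of f at a
    monomial outside (x^a, z^c) reappears in y^b f and hence vanishes. *)
Lemma ps_mono_regular a b c :
  regular_triple (ps_mono k a 0 0) (ps_mono k 0 0 c) (ps_mono k 0 b 0).
Proof.
split=> [f E|f g E|f g h E].
- apply: ps_ext => i j l; have := ps_monoE a 0 0 f (i + a) j l.
  by rewrite E leq_addl /= addnK !subn0 => <-.
- exists (fun i j l => f (i + a)%N j l); apply: ps_ext => i j l.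
  rewrite ps_monoE !subn0 !andbT; case: leqP => [le_ai|lt_ia].
    by rewrite subnK.
  have := ps_monoE 0 0 c f i j (l + c); rewrite E ps_monoE leq_addl addnK !subn0.
  by rewrite leqNgt lt_ia.
- exists (fun i j l => f (i + a)%N j l).
  (* The bound on i keeps terms divisible by x^a from being counted twice. *)
  exists (fun i j l => if (i < a)%N then f i j (l + c)%N else 0).
  apply: ps_ext => i j l; rewrite ps_addE !ps_monoE !subn0 !andbT /=.
  case: leqP => [le_ai|lt_ia]; first by rewrite subnK // if_same addr0.
  case: leqP => [le_cl|lt_lc]; first by rewrite subnK // add0r.
  have := ps_monoE 0 b 0 f i (j + b) l; rewrite E ps_addE !ps_monoE leq_addl addnK.
  by rewrite !subn0 /= (leqNgt a) (leqNgt c) lt_ia lt_lc ?andbF /= ?addr0 => <-.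
Qed.

Lemma ps_const_eq0P f : ps_const f = 0 <->
  exists a b c, f = ps_mono k 1 0 0 * a + ps_mono k 0 0 1 * b + ps_mono k 0 1 0 * c.
Proof.
split=> [f0|[a [b [c ->]]]].
  (* Each monomial is assigned to x if x divides it, otherwise to z, otherwise to y. *)
  exists (fun i j l => f i.+1 j l), (fun i j l => if i == 0%N then f i j l.+1 else 0).
  exists (fun i j l => if (i == 0%N) && (l == 0%N) then f i j.+1 l else 0).
  apply: ps_ext => i j l; rewrite !ps_addE !ps_monoE !subn0 !andbT /=.
  case: i => [|i] /=; last by rewrite subn1 /= !if_same !addr0.
  rewrite add0r; case: l => [|l] /=; last by rewrite subn1 /= if_same addr0.
  rewrite add0r; case: j => [|j] /=; first exact: f0.
  by rewrite subn1.
by rewrite /ps_const !ps_addE !ps_monoE /= !addr0.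
Qed.

Definition ps_order_ge n f := forall i j l, (i + j + l < n)%N -> f i j l = 0.

Lemma ps_order_geM m n f g :
  ps_order_ge m f -> ps_order_ge n g -> ps_order_ge (m + n) (f * g).
Proof.
move=> fm gn i j l lt_mn; rewrite ps_mulE.
apply: big1 => i' _; apply: big1 => j' _; apply: big1 => l' _.
have [lt_m|le_m] := ltnP (i' + j' + l') m; first by rewrite fm ?mul0r.
rewrite gn ?mulr0 // -(ltn_add2l (i' + j' + l')).
apply: leq_trans (leq_add le_m (leqnn n)); apply: leq_trans lt_mn.
rewrite ltnS; have := (ltn_ord i', ltn_ord j', ltn_ord l').
rewrite !ltnS => -[[le_i le_j] le_l].
by rewrite addnACA (addnACA i') !subnKC.
Qed.

Lemma ps_order_geX n f : ps_order_ge 1 f -> ps_order_ge n (f ^+ n).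
Proof. by move=> f1; elim: n => // n IH; rewrite exprS; apply: (@ps_order_geM 1). Qed.

Lemma ps_geometric_inv f : ps_const f = 0 -> exists g, g * (1 - f) = 1.
Proof.
move=> f0; have f1 : ps_order_ge 1 f.
  by move=> [|i] [|j] [|l] //=; rewrite ?addn0 ?addnS.
pose S n : Q := \sum_(u < n) f ^+ u.
(* The geometric series, coefficient by coefficient: f^u has order at least u, so only the powers up
   to i + j + l contribute here. *)
exists (fun i j l => S (i + j + l).+1 i j l).
have SE n i j l : (i + j + l < n)%N -> S (i + j + l).+1 i j l = S n i j l.
  move=> lt_n; rewrite /S -(subnKC lt_n) big_split_ord /= ps_addE.
  rewrite -[LHS]addr0; congr (_ + _); rewrite ps_sumE big1 // => u _.
  by apply: (ps_order_geX f1); rewrite addSn ltnS leq_addr.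
apply: ps_ext => i j l; pose n := (i + j + l).+1.
transitivity ((S n * (1 - f)) i j l).
  rewrite !ps_mulE; apply: eq_bigr => i' _; apply: eq_bigr => j' _.
  apply: eq_bigr => l' _; congr (_ * _); apply: SE; rewrite ltnS.
  by rewrite !leq_add // -ltnS ltn_ord.
have -> : S n * (1 - f) = 1 - f ^+ n.
  rewrite mulrC -opprB mulNr -subrX1 opprB //.
rewrite ps_addE ps_oppE (ps_order_geX f1) ?subr0 //.
Qed.

Definition ps_cst (c : k) : Q := fun i j l => if (i + j + l)%N is 0 then c else 0.

Lemma ps_const_cst c : ps_const (ps_cst c) = c.
Proof. by []. Qed.

Lemma ps_maxidealP f : maxideal f <-> ps_const f = 0.
Proof.
split=> [max_f|f0 g /(congr1 (@ps_const k))]; last first.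
  by rewrite rmorphM rmorph1 [X in _ * X]f0 mulr0 => /esym/eqP; rewrite oner_eq0.
apply: contrapT => /eqP nz_f; set c := ps_const f in nz_f.
(* Dividing f by its constant term c leaves 1 minus a series without constant term. *)
have [g Eg] : exists g, g * (1 - (1 - ps_cst c^-1 * f)) = 1.
  apply: ps_geometric_inv; rewrite rmorphB rmorph1 rmorphM /= ps_const_cst.
  by rewrite mulVf ?subrr.
by apply: (max_f (g * ps_cst c^-1)); rewrite -mulrA -[RHS]Eg subKr.
Qed.

Lemma ps_maxideal_genP f : maxideal f <->
  exists a b c, f = ps_mono k 1 0 0 * a + ps_mono k 0 0 1 * b + ps_mono k 0 1 0 * c.
Proof. by apply: iff_trans (ps_maxidealP f) (ps_const_eq0P f). Qed.

(** * Quotients by ideals inside the square of the maximal ideal *)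

Section Quotient.
Variables (R : comNzRingType) (pi : {rmorphism Q -> R}).
Hypothesis pi_surj : forall a : R, exists q, pi q = a.

(** For f in the maximal ideal m, the coordinates of its class in m/m^2, in the order x, z, y. *)
Definition ps_lin f : 'rV[k]_3 :=
  \row_i tnth [tuple f 1 0 0; f 0 0 1; f 0 1 0]%N i.

Hypothesis pi_ker : forall q, pi q = 0 -> ps_const q = 0 /\ ps_lin q = 0.

Lemma quot_maxidealE q : maxideal (pi q) <-> maxideal q.
Proof.
split=> [max_q g E|/ps_maxidealP q0 a].
  by apply: (max_q (pi g)); rewrite -rmorphM E rmorph1.
have [g <-] := pi_surj a; rewrite -rmorphM -(rmorph1 pi) => /eqP.
rewrite -subr_eq0 -rmorphB => /eqP/pi_ker[/eqP].
rewrite rmorphB rmorphM rmorph1 [X in _ * X]q0 mulr0 sub0r oppr_eq0 oner_eq0 //.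
Qed.

Lemma quot_local : local_ring R.
Proof.
move=> a b; have [f <-] := pi_surj a; have [g <-] := pi_surj b.
move=> /quot_maxidealE/ps_maxidealP f0 /quot_maxidealE/ps_maxidealP g0.
rewrite -rmorphD; apply/quot_maxidealE/ps_maxidealP.
by rewrite rmorphD [X in X + _]f0 [X in _ + X]g0 addr0.
Qed.

Lemma ps_linM f g : ps_const g = 0 -> ps_lin (f * g) = ps_const f *: ps_lin g.
Proof.
rewrite /ps_const => g0; apply/rowP => i; rewrite !mxE !(tnth_nth 0).
by case: i => [[|[|[|//]]] lti] /=; rewrite ps_mulE !(big_ord_recl, big_ord0) /= g0;
  rewrite ?mulr0 ?addr0.
Qed.

Lemma ps_linD f g : ps_lin (f + g) = ps_lin f + ps_lin g.
Proof.
apply/rowP => i; rewrite !mxE !(tnth_nth 0).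
by case: i => [[|[|[|//]]] lti].
Qed.

Lemma ps_lin0 : ps_lin 0 = 0.
Proof. by apply: (addIr (ps_lin 0)); rewrite -ps_linD !add0r. Qed.

Lemma ps_lin_sum n (f : 'I_n -> Q) : ps_lin (\sum_i f i) = \sum_i ps_lin (f i).
Proof. by apply: big_morph; [exact: ps_linD | exact: ps_lin0]. Qed.

Definition ps_vars : 3.-tuple Q :=
  [tuple ps_mono k 1 0 0; ps_mono k 0 0 1; ps_mono k 0 1 0].

Lemma ps_lin_vars i : ps_lin (tnth ps_vars i) = delta_mx 0 i.
Proof.
apply/rowP => j; rewrite !mxE !(tnth_nth 0) /=.
by case: i => [[|[|[|//]]] lti]; case: j => [[|[|[|//]]] ltj].
Qed.

Lemma mem_gen_ideal (S : comNzRingType) (s : seq S) a : a \in s -> a \in gen_ideal s.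
Proof.
move=> /(nthP 0)[i lti <-]; apply/asboolP.
exists (fun j => (j == Ordinal lti)%:R).
rewrite (bigD1 (Ordinal lti)) //= eqxx mul1r big1 ?addr0 // => j /negbTE->.
by rewrite mul0r.
Qed.

Lemma quot_embdim : embdim R 3.
Proof.
split.
  exists (map pi ps_vars); split=> // a.
  have [q <-] := pi_surj a; rewrite quot_maxidealE ps_maxideal_genP.
  split=> [[f [g [h ->]]]|/asboolP[c E]].
    apply/asboolP; exists (fun i : 'I_3 => pi (tnth [tuple f; g; h] i)).
    rewrite !big_ord_recl big_ord0 /= !rmorphD !rmorphM addr0 addrA /=.
    by rewrite ![_ * pi (ps_mono _ _ _ _)]mulrC.
  have /choice[g gP] := fun i : 'I_3 => pi_surj (c i).
  apply/ps_maxideal_genP/quot_maxidealE; rewrite E.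
  rewrite (eq_bigr (fun i : 'I_3 => pi (g i * ps_vars`_i))) => [|i _]; last first.
    by rewrite rmorphM gP (nth_map 0) ?size_tuple.
  rewrite -rmorph_sum; apply/quot_maxidealE/ps_maxideal_genP.
  exists (g 0), (g (lift 0 0)), (g (lift 0 (lift 0 0))); rewrite !big_ord_recl big_ord0 /=.
  by rewrite addr0 addrA ![_ * g _]mulrC.
move=> s gen_s.
have /choice[q qP] : forall i : 'I_(size s), exists q, pi q = s`_i /\ ps_const q = 0.
  move=> i; have [q Eq] := pi_surj s`_i; exists q; split=> //.
  apply/ps_maxidealP/quot_maxidealE; rewrite Eq; apply/gen_s.
  exact/mem_gen_ideal/mem_nth.
(* Up to the kernel, which has no linear part, each variable is a combination of lifts of s. Hence
   the linear parts of these lifts span k^3, and a rank count bounds [size s]. *)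
have /choice[c cP] : forall j : 'I_3, exists c : 'I_(size s) -> Q,
    delta_mx 0 j = \sum_i ps_const (c i) *: ps_lin (q i).
  move=> j; have /asboolP[c Ec] : pi (tnth ps_vars j) \in gen_ideal s.
    apply/gen_s/quot_maxidealE/ps_maxidealP; rewrite (tnth_nth 0).
    by case: j => [[|[|[|//]]] ltj].
  have /choice[g gP] := fun i => pi_surj (c i); exists g.
  have /pi_ker[_] : pi (tnth ps_vars j - \sum_i g i * q i) = 0.
    rewrite rmorphB rmorph_sum Ec; apply/eqP; rewrite subr_eq0; apply/eqP.
    by apply: eq_bigr => i _; rewrite rmorphM gP; have [->] := qP i.
  set S := \sum_i _; set v := tnth _ _ => E.
  rewrite -ps_lin_vars -/v -[v](subrK S) ps_linD E add0r ps_lin_sum.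
  by apply: eq_bigr => i _; rewrite ps_linM //; have [] := qP i.
pose C : 'M[k]_(3, size s) := \matrix_(j, i) ps_const (c j i).
pose L : 'M[k]_(size s, 3) := \matrix_i ps_lin (q i).
have CL : C *m L = 1%:M.
  apply/row_matrixP => j; rewrite row1 cP row_mul mulmx_sum_row.
  by apply: eq_bigr => i _; rewrite rowK !mxE.
rewrite -(mxrank1 k 3) -CL; apply: leq_trans (mxrankM_maxr _ _) (rank_leq_row _).
Qed.

End Quotient.
End PowerSeries.

(** * Sparse integer polynomials and explicit resolutions *)

Definition exponent := (nat * nat * nat)%type.
(** Exponents may repeat, so that addition is concatenation. With integer coefficients one
    computation serves all fields k. *)
Definition zpoly := seq (int * exponent).

Definition zcoef (m : exponent) (p : zpoly) : int :=
  foldr (fun t c => if t.2 == m then t.1 + c else c) 0 p.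
Definition zopp (p : zpoly) : zpoly := [seq (- t.1, t.2) | t <- p].
Definition zmul (p q : zpoly) : zpoly :=
  [seq (s.1 * t.1, (s.2.1.1 + t.2.1.1, s.2.1.2 + t.2.1.2, s.2.2 + t.2.2)%N)
    | s <- p, t <- q].
Definition zsum n (F : nat -> zpoly) : zpoly := flatten [seq F i | i <- iota 0 n].
(** It suffices to test the exponents that occur; all others have coefficient 0. *)
Definition znull (p : zpoly) : bool := all (fun t => zcoef t.2 p == 0) p.
Definition zcst : zpoly -> int := zcoef (0, 0, 0)%N.

Section Evaluation.
Variable k : fieldType.
Local Notation Q := (pseries3 k).

Definition zeval (p : zpoly) : Q :=
  \sum_(t <- p) ps_mono k t.2.1.1 t.2.1.2 t.2.2 *~ t.1.

Lemma ps_mulzE (f : Q) n i j l : (f *~ n) i j l = f i j l *~ n.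
Proof.
have mulnE m : (f *+ m) i j l = f i j l *+ m.
  by elim: m => [//|m IH]; rewrite !mulrS ps_addE IH.
case: n => n; first exact: mulnE.
by rewrite !NegzE !mulrNz ps_oppE [X in - X]mulnE.
Qed.

Lemma zeval_coef p i j l : zeval p i j l = (zcoef (i, j, l) p)%:~R.
Proof.
rewrite /zeval ps_sumE; elim: p => [|[n [[a b] c]] p IH] /=; first by rewrite big_nil.
rewrite big_cons IH /= -[_ i j l]/(((ps_mono k a b c *~ n) : Q) i j l).
have -> : (ps_mono k a b c *~ n) i j l = ((i == a) && (j == b) && (l == c))%:R *~ n.
  exact: ps_mulzE.
rewrite !xpair_eqE (eq_sym a) (eq_sym b) (eq_sym c).
by case: (_ && _); rewrite /= ?intrD // mul0rz add0r.
Qed.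

Lemma zcoef_notin m p : m \notin [seq t.2 | t <- p] -> zcoef m p = 0.
Proof.
elim: p => //= t p IH; rewrite inE negb_or eq_sym => /andP[/negbTE-> /IH].
by [].
Qed.

Lemma znullP p : znull p -> zeval p = 0.
Proof.
move=> /allP p0; apply: ps_ext => i j l; rewrite zeval_coef.
have [/mapP[t /p0/eqP E ->]|/zcoef_notin->] // := boolP ((i, j, l) \in [seq t.2 | t <- p]).
by rewrite E.
Qed.

Lemma zeval0 : zeval [::] = 0.
Proof. exact: big_nil. Qed.

Lemma zeval_cat p q : zeval (p ++ q) = zeval p + zeval q.
Proof. exact: big_cat. Qed.

Lemma zeval_opp p : zeval (zopp p) = - zeval p.
Proof.
rewrite /zeval big_map -sumrN; apply: eq_bigr => t _ /=; exact: mulrNz.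
Qed.

Lemma zeval_mul p q : zeval (zmul p q) = zeval p * zeval q.
Proof.
rewrite /zeval /zmul big_allpairs_dep big_distrlr /=.
apply: eq_bigr => s _; apply: eq_bigr => t _.
by rewrite -ps_monoM mulrzAl mulrzAr -mulrzA [t.1 * _]mulrC.
Qed.

Lemma zeval_sum n F : zeval (zsum n F) = \sum_(i < n) zeval (F i).
Proof.
rewrite /zsum -(big_mkord xpredT (fun i => zeval (F i))) /index_iota subn0.
by rewrite /zeval big_flatten big_map.
Qed.

Lemma zeval_cst p : ps_const (zeval p) = (zcst p)%:~R.
Proof. exact: zeval_coef. Qed.

Definition zmatrix m n (e : nat -> nat -> zpoly) : 'M[Q]_(m, n) :=
  \matrix_(i < m, j < n) zeval (e i j).

Definition zmulmx n (e f : nat -> nat -> zpoly) i j : zpoly :=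
  zsum n (fun l => zmul (e i l) (f l j)).

Lemma zmatrixM m n p e f :
  zmatrix m n e *m zmatrix n p f = zmatrix m p (zmulmx n e f).
Proof.
apply/matrixP => i j; rewrite !mxE zeval_sum; apply: eq_bigr => l _.
by rewrite !mxE zeval_mul.
Qed.

End Evaluation.

Record zresolution := ZResolution {
  zr1 : nat; zr2 : nat; zr3 : nat;
  zd1 : seq zpoly; zd2 : seq (seq zpoly); zd3 : seq (seq zpoly);
  (* An entry (i, j, l, p) stands for the term p f_l of e_i e_j, where i < j
     (resp. the term p g_l of e_i f_j). *)
  zt11 : seq (nat * nat * nat * zpoly);
  zt12 : seq (nat * nat * nat * zpoly)
}.

Definition zentry (T : seq (nat * nat * nat * zpoly)) i j l : zpoly :=
  flatten [seq e.2 | e <- T & e.1 == (i, j, l)].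
Definition zdelta (i j : nat) (p : zpoly) : zpoly := if i == j then p else [::].
Definition all_below n (P : pred nat) := all P (iota 0 n).
Definition zmxeq m n (e f : nat -> nat -> zpoly) :=
  all_below m (fun i => all_below n (fun j => znull (e i j ++ zopp (f i j)))).

(** * Decidable conditions on the data of a resolution *)

Section Checks.
Variable D : zresolution.
Local Notation r1 := (zr1 D).
Local Notation r2 := (zr2 D).
Local Notation r3 := (zr3 D).

Definition ze1 i (_ : nat) := nth [::] (zd1 D) i.
Definition ze2 i j := nth [::] (nth [::] (zd2 D) i) j.
Definition ze3 i j := nth [::] (nth [::] (zd3 D) i) j.
(** Antisymmetrizing a table given for i < j makes graded commutativity hold by construction. *)
Definition zA i j l := zentry (zt11 D) i j l ++ zopp (zentry (zt11 D) j i l).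
Definition zB i j l := zentry (zt12 D) i j l.

Definition zcomplex : bool :=
  zmxeq r2 1 (zmulmx r1 ze2 ze1) (fun _ _ => [::]) &&
  zmxeq r3 r1 (zmulmx r2 ze3 ze2) (fun _ _ => [::]).

(** The summand [zdelta i l (ze1 j 0)] is an entry of d_1 times the i-th unit row; row j of the
    first identity is the Leibniz rule for e_i e_j. *)
Definition zhomotopy : bool := all_below r1 (fun i =>
  [&& zmxeq r1 r1 (fun j l => zmulmx r2 (zA i) ze2 j l ++ zdelta i l (ze1 j 0))
        (fun j l => zdelta j l (ze1 i 0)),
      zmxeq r2 r2 (fun j l => zmulmx r3 (zB i) ze3 j l ++ zmulmx r1 ze2 (zA i) j l)
        (fun j l => zdelta j l (ze1 i 0))
    & zmxeq r3 r3 (zmulmx r2 ze3 (zB i)) (fun j l => zdelta j l (ze1 i 0))]).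

(** Terms of degree at least 2 place the ideal in m^2, which gives embedding dimension 3; the
    leading x^3 and z^3 start the regular sequence. *)
Definition zgenerators : bool :=
  [&& size (zd1 D) == r1,
      all (all (fun t : int * exponent => 1 < t.2.1.1 + t.2.1.2 + t.2.2)%N) (zd1 D)
    & take 2 (zd1 D) == [:: [:: (1, (3, 0, 0)%N)]; [:: (1, (0, 0, 3)%N)]]].

Definition zminimal : bool :=
  all_below r2 (fun i => all_below r1 (fun j => zcst (ze2 i j) == 0)) &&
  all_below r3 (fun i => all_below r2 (fun j => zcst (ze3 i j) == 0)).

Definition zclass_B : bool :=
  [&& (1 < r1)%N, (2 < r2)%N, (0 < r3)%N,
      all_below r1 (fun i => all_below r1 (fun j => all_below r2 (fun l =>
        (i < j)%N ==> (zcst (zA i j l) == ((i, j, l) == (0, 1, 2)%N)%:Z))))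
    & all_below r1 (fun i => all_below r2 (fun j => all_below r3 (fun l =>
        zcst (zB i j l) == (((i, j) \in [:: (0, 0); (1, 1)]%N) && (l == 0%N))%:Z)))].

Definition zcheck : bool :=
  [&& zcomplex, zhomotopy, zgenerators, zminimal & zclass_B].

End Checks.

Lemma all_belowP n (P : pred nat) : reflect (forall i : 'I_n, P i) (all_below n P).
Proof.
apply: (iffP allP) => [Pn i|Pn i]; first by apply: Pn; rewrite mem_iota /=.
by rewrite mem_iota => lti; apply: (Pn (Ordinal lti)).
Qed.

(** Coefficients indexed by [nat] allow [size s] to be rewritten. *)
Lemma gen_idealP (S : comNzRingType) (s : seq S) q :
  q \in gen_ideal s <-> exists c : nat -> S, q = \sum_(i < size s) c i * s`_i.
Proof.
split=> [/asboolP[c ->]|[c ->]]; last by apply/asboolP; exists (fun i => c i).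
exists (fun i => if insub i is Some u then c u else 0).
by apply: eq_bigr => i _; rewrite valK.
Qed.

Lemma basis_delta_mx (K : fieldType) n :
  basis_of fullv [tuple delta_mx 0 i : 'rV[K]_n | i < n].
Proof.
rewrite basisEdim size_tuple dimvf dim_matrix mul1r leqnn andbT.
apply/subvP => v _; rewrite [v]row_sum_delta; apply: memv_suml => i _.
by apply/memvZ/memv_span/tnthP; exists i; rewrite tnth_mktuple.
Qed.

Lemma bilin_delta (S : comNzRingType) p q r (M : 'I_p -> 'I_q -> 'rV[S]_r) i j :
  bilin M (delta_mx 0 i) (delta_mx 0 j) = M i j.
Proof.
rewrite /bilin (bigD1 i) //= (bigD1 j) //= !mxE !eqxx mulr1 scale1r.
rewrite !big1 ?addr0 // => [i'|j'] neq; rewrite ?mxE.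
  by apply: big1 => j' _; rewrite !mxE (negbTE neq) andbF mul0r scale0r.
by rewrite (negbTE neq) andbF mulr0 scale0r.
Qed.

(** * From checked data to the local ring and its class *)

Section Realization.
Variables (k : fieldType) (D : zresolution).
Local Notation Q := (pseries3 k).
Local Notation r1 := (zr1 D).
Local Notation r2 := (zr2 D).
Local Notation r3 := (zr3 D).

Definition real1 : 'M[Q]_(r1, 1) := zmatrix k r1 1 (ze1 D).
Definition real2 : 'M[Q]_(r2, r1) := zmatrix k r2 r1 (ze2 D).
Definition real3 : 'M[Q]_(r3, r2) := zmatrix k r3 r2 (ze3 D).
Definition realA (i : 'I_r1) : 'M[Q]_(r1, r2) := zmatrix k r1 r2 (zA D i).
Definition realB (i : 'I_r1) : 'M[Q]_(r2, r3) := zmatrix k r2 r3 (zB D i).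

Lemma zmxeqP m n e f : zmxeq m n e f -> zmatrix k m n e = zmatrix k m n f.
Proof.
move=> /all_belowP E; apply/matrixP => i j; rewrite !mxE.
have /all_belowP/(_ j)/(znullP k) := E i.
by rewrite zeval_cat zeval_opp => /eqP; rewrite subr_eq0 => /eqP.
Qed.

Lemma zmatrix_nil m n : zmatrix k m n (fun _ _ => [::]) = 0.
Proof. by apply/matrixP => i j; rewrite !mxE zeval0. Qed.

Lemma zmatrix_scalar n p : zmatrix k n n (fun i j => zdelta i j p) = (zeval k p)%:M.
Proof.
apply/matrixP => i j; rewrite !mxE /zdelta val_eqE.
by case: eqP => _; rewrite ?zeval0.
Qed.

Lemma zmatrixD m n e f :
  zmatrix k m n (fun i j => e i j ++ f i j) = zmatrix k m n e + zmatrix k m n f.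
Proof. by apply/matrixP => i j; rewrite !mxE zeval_cat. Qed.

Lemma realA_diag i : row i (realA i) = 0.
Proof. by apply/rowP => l; rewrite !mxE zeval_cat zeval_opp subrr. Qed.

Lemma realA_anti i j : row j (realA i) = - row i (realA j).
Proof. by apply/rowP => l; rewrite !mxE !zeval_cat !zeval_opp opprB. Qed.

Hypothesis check : zcheck D.

Lemma check_complex : real2 *m real1 = 0 /\ real3 *m real2 = 0.
Proof.
have /and5P[/andP[E21 E32] _ _ _ _] := check.
by rewrite /real1 /real2 /real3 !zmatrixM (zmxeqP E21) (zmxeqP E32) !zmatrix_nil.
Qed.

Lemma check_homotopy (i : 'I_r1) :
  [/\ realA i *m real2 + real1 *m delta_mx 0 i = (real1 i 0)%:M,
      realB i *m real3 + real2 *m realA i = (real1 i 0)%:M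
    & real3 *m realB i = (real1 i 0)%:M].
Proof.
have /and5P[_ /all_belowP/(_ i)/and3P[E1 E2 E3] _ _ _] := check.
rewrite [real1 i 0]mxE -!zmatrix_scalar -(zmxeqP E1) -(zmxeqP E2) -(zmxeqP E3).
rewrite !zmatrixD !zmatrixM; split=> //; congr (_ + _).
apply/matrixP => j l; rewrite !mxE big_ord1 !mxE /zdelta val_eqE.
by rewrite eqxx [in RHS]eq_sym; case: eqP => _; rewrite ?zeval0 ?mulr1 ?mulr0.
Qed.

Lemma check_gt : [/\ (1 < r1)%N, (2 < r2)%N & (0 < r3)%N].
Proof. by have /and5P[_ _ _ _ /and5P[]] := check. Qed.

Lemma check_regular b : exists u1 u2,
  regular_triple (aug real1 u1) (aug real1 u2) (ps_mono k 0 b 0).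
Proof.
have [gt1 _ _] := check_gt; have /and5P[_ _ /and3P[_ _ /eqP E] _ _] := check.
exists (delta_mx 0 (Ordinal (ltnW gt1))), (delta_mx 0 (Ordinal gt1)).
have Ez : ze1 D 0 0 = [:: (1, (3, 0, 0)%N)] /\ ze1 D 1 0 = [:: (1, (0, 0, 3)%N)].
  by rewrite /ze1; move: E; case: (zd1 D) => [|p0 [|p1 s]] //= [-> -> _].
rewrite /aug -!rowE !mxE /=; case: Ez => -> ->.
rewrite /zeval !big_cons !big_nil !addr0 /=.
exact: ps_mono_regular.
Qed.

Variables (R : comNzRingType) (pi : {rmorphism Q -> R}).
Hypothesis pi_surj : forall a : R, exists q, pi q = a.
Hypothesis pi_kerE : forall q,
  pi q = 0 <-> q \in gen_ideal [seq zeval k p | p <- zd1 D].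

Lemma check_exact0 q : pi q = 0 <-> exists v : 'rV_r1, (v *m real1) 0 0 = q.
Proof.
have /and5P[_ _ /and3P[/eqP sz _ _] _ _] := check.
rewrite pi_kerE gen_idealP size_map sz; split=> [[c ->]|[v <-]].
  exists (\row_i c i); rewrite mxE; apply: eq_bigr => i _.
  by rewrite !mxE (nth_map [::]) ?sz.
exists (fun i => if insub i is Some u then v 0 u else 0).
rewrite mxE; apply: eq_bigr => i _.
by rewrite valK !mxE (nth_map [::]) ?sz.
Qed.

Lemma check_ker q : pi q = 0 -> ps_const q = 0 /\ ps_lin q = 0.
Proof.
have /and5P[_ _ /and3P[/eqP sz deg2 _] _ _] := check.
have low p i j l : p \in zd1 D -> (i + j + l < 2)%N -> zeval k p i j l = 0.
  move=> /(allP deg2)/allP degp lt2; rewrite zeval_coef zcoef_notin //.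
  by apply/mapP => -[t /degp + Et]; rewrite -Et /= ltnNge -ltnS lt2.
have low0 (i : 'I_r1) : ps_const (real1 i 0) = 0 /\ ps_lin (real1 i 0) = 0.
  rewrite mxE; have mem : ze1 D i 0 \in zd1 D by apply: mem_nth; rewrite sz.
  split; first exact: low.
  by apply/rowP => -[[|[|[|//]]] ltj]; rewrite !mxE (tnth_nth 0) /= low.
move=> /check_exact0[v <-]; rewrite mxE; split.
  rewrite rmorph_sum big1 // => i _; rewrite rmorphM.
  by have [E _] := low0 i; rewrite [X in _ * X]E mulr0.
rewrite ps_lin_sum big1 // => i _; have [E0 E1] := low0 i.
by rewrite ps_linM // E1 scaler0.
Qed.

Lemma check_minimal : [/\ forall i j, maxideal (real1 i j),
  forall i j, maxideal (real2 i j) & forall i j, maxideal (real3 i j)].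
Proof.
have /and5P[_ _ _ /andP[/all_belowP m2 /all_belowP m3] _] := check.
split=> i j; apply/ps_maxidealP.
- rewrite ord1; suff /check_ker[] : pi (real1 i 0) = 0 by [].
  by apply/check_exact0; exists (delta_mx 0 i); rewrite -rowE mxE.
- by have /all_belowP/(_ j)/eqP E := m2 i; rewrite mxE zeval_cst E.
- by have /all_belowP/(_ j)/eqP E := m3 i; rewrite mxE zeval_cst E.
Qed.

Variable b : nat.
Hypothesis y_kills_homology1 : forall v : 'rV[Q]_r1,
  v *m real1 = 0 -> exists w : 'rV_r2, w *m real2 = ps_mono k 0 b 0 *: v.

Lemma check_dg_resolution : exists F : dg_resolution pi r1 r2 r3,
  dg_11 F = (fun i j => row j (realA i)) /\ dg_12 F = (fun i j => row j (realB i)).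
Proof.
have [d21 d32] := check_complex; have [u1 [u2 reg]] := check_regular b.
have [m1 m2 m3] := check_minimal.
have [F [_ F1112]] : exists F : dg_resolution pi r1 r2 r3, _ /\ _ :=
  homotopy_dg_resolution d21 d32 realA_diag realA_anti
  (fun i => let: And3 H _ _ := check_homotopy i in H)
  (fun i => let: And3 _ H _ := check_homotopy i in H)
  (fun i => let: And3 _ _ H := check_homotopy i in H)
  reg y_kills_homology1 check_exact0 m1 m2 m3.
by exists F; case: F1112.
Qed.

Lemma check_cmtype : depth R 0 /\ cmtype R r3.
Proof.
have [F _] := check_dg_resolution; have [_ _ gt3] := check_gt.
have reg := ps_mono_regular k 1 1 1.
have maxP := @ps_maxideal_genP k; have maxR := quot_maxidealE pi_surj check_ker.
by split; [apply: (depth0 F reg) | apply: (cmtype_rank F reg)].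
Qed.

Lemma check_embcodepth : embcodepth R 3.
Proof.
exists 3%N, 0%N; split=> //; first exact: quot_embdim pi_surj check_ker.
by have [] := check_cmtype.
Qed.

Lemma check_class_B : class_B (@ps_const k) pi.
Proof.
split; [split => // | split; first exact: check_embcodepth].
(* Q is treated as its own quotient under the identity. *)
- by apply: (@quot_local k Q idfun) => [a|q /= ->]; [exists a | rewrite ps_lin0].
- split=> [a|q]; first by exists (ps_cst a).
  by rewrite ps_maxidealP.
- exists 3%N; split; last exact: quot_embdim pi_surj check_ker.
  by apply: (@quot_embdim k Q idfun) => [a|q /= ->]; [exists a | rewrite ps_lin0].
have [F [F11 F12]] := check_dg_resolution; exists r1, r2, r3, F.
(* The data are arranged so that the standard bases already multiply as class B requires. *)
exists [tuple delta_mx 0 i | i < r1], [tuple delta_mx 0 i | i < r2].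
exists [tuple delta_mx 0 i | i < r3].
have [gt1 gt2 gt3] := check_gt.
have /and5P[_ _ _ _ /and5P[_ _ _ cA cB]] := check.
have nthE n i (lti : (i < n)%N) :
    [tuple (delta_mx 0 i : 'rV[k]_n) | i < n]`_i = delta_mx 0 (Ordinal lti).
  by rewrite -[i]/(val (Ordinal lti)) -tnth_nth tnth_mktuple.
have torA (i j : 'I_r1) (l : 'I_r2) : (i < j)%N ->
    tor_11 (@ps_const k) F (delta_mx 0 i) (delta_mx 0 j) 0 l
    = ((i : nat, j : nat, l : nat) == (0, 1, 2)%N)%:R.
  move=> ltij; rewrite /tor_11 bilin_delta F11 !mxE [LHS]zeval_cst.
  move/all_belowP: cA => /(_ i)/all_belowP/(_ j)/all_belowP/(_ l).
  by rewrite ltij => /eqP->.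
have torB (i : 'I_r1) (j : 'I_r2) (l : 'I_r3) :
    tor_12 (@ps_const k) F (delta_mx 0 i) (delta_mx 0 j) 0 l
    = (((i : nat, j : nat) \in [:: (0, 0); (1, 1)]%N) && (l == 0%N :> nat))%:R.
  rewrite /tor_12 bilin_delta F12 !mxE [LHS]zeval_cst.
  by move/all_belowP: cB => /(_ i)/all_belowP/(_ j)/all_belowP/(_ l)/eqP->.
split; first by split; apply: basis_delta_mx.
- by [].
- rewrite (nthE _ _ (ltnW gt1)) (nthE _ _ gt1) (nthE _ _ (ltnW (ltnW gt2))).
  rewrite (nthE _ _ (ltnW gt2)) (nthE _ _ gt2) (nthE _ _ gt3).
  by split; apply/rowP => l; rewrite ?torA // ?torB // mxE.
- move=> i j /andP[ltij ltj] ne; have lti := ltn_trans ltij ltj.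
  rewrite (nthE _ _ lti) (nthE _ _ ltj); apply/rowP => l; rewrite torA // mxE.
  by rewrite xpair_eqE (negbTE ne).
move=> i j lti ltj ne0 ne1; rewrite (nthE _ _ lti) (nthE _ _ ltj).
by apply/rowP => l; rewrite torB mxE !inE (negbTE ne0) (negbTE ne1).
Qed.

End Realization.

Definition zmono (a b c : nat) : zpoly := [:: (1, (a, b, c))].
Arguments zmono : simpl never.
Arguments zopp : simpl never.

(** * Explicit resolutions and multiplication tables *)

Section Data.
Local Notation P := zmono.
Local Notation N a b c := (zopp (zmono a b c)).
Local Notation O := ([::] : zpoly).
(** The generators x^3 and z^3 come first, as the e_1 and e_2 of class B; row 2 of d_2, counted from
    0, is their Koszul relation, the boundary of e_1 e_2. *)
Definition res1 : zresolution := 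
  (ZResolution 4 4 1
  [:: P 3 0 0; P 0 0 3; P 2 1 0; P 0 1 2]
  [:: [:: O; N 0 1 0; O; P 0 0 1];
      [:: P 0 1 0; O; N 1 0 0; O];
      [:: N 0 0 3; P 3 0 0; O; O];
      [:: O; O; N 0 0 2; P 2 0 0]]
  [:: [:: P 3 0 0; P 0 0 3; P 0 1 0; N 1 0 1]]
  [:: (0,1,2, P 0 0 0); (0,2,1, N 2 0 0); (0,3,1, N 0 0 2); (0,3,3, P 1 0 0);
      (1,2,0, P 2 0 0); (1,2,3, N 0 0 1); (1,3,0, P 0 0 2); (2,3,3, P 0 1 0)]
  [:: (0,0,0, P 0 0 0); (1,1,0, P 0 0 0); (2,2,0, P 2 0 0); (3,2,0, P 0 0 2)])%N.

(** The last syzygy of [res1], between x^2 y and y z^2, breaks up into two linear ones through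
    xyz. *)
Definition res2 : zresolution := 
  (ZResolution 5 5 1
  [:: P 3 0 0; P 0 0 3; P 2 1 0; P 0 1 2; P 1 1 1]
  [:: [:: O; N 0 1 0; O; P 0 0 1; O];
      [:: P 0 1 0; O; N 1 0 0; O; O];
      [:: N 0 0 3; P 3 0 0; O; O; O];
      [:: O; O; O; N 1 0 0; P 0 0 1];
      [:: O; O; N 0 0 1; O; P 1 0 0]]
  [:: [:: P 3 0 0; P 0 0 3; P 0 1 0; P 2 0 1; N 1 0 2]]
  [:: (0,1,2, P 0 0 0); (0,2,1, N 2 0 0); (0,3,1, N 0 0 2); (0,3,3, N 2 0 0);
      (0,3,4, P 1 0 1); (0,4,1, N 1 0 1); (0,4,4, P 2 0 0); (1,2,0, P 2 0 0);
      (1,2,3, P 1 0 1); (1,2,4, N 0 0 2); (1,3,0, P 0 0 2); (1,4,0, P 1 0 1);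
      (1,4,3, P 0 0 2); (2,3,3, N 1 1 0); (2,3,4, P 0 1 1); (2,4,4, P 1 1 0);
      (3,4,3, P 0 1 1)]
  [:: (0,0,0, P 0 0 0); (1,1,0, P 0 0 0); (2,2,0, P 2 0 0); (3,2,0, P 0 0 2);
      (4,2,0, P 1 0 1)])%N.

(** The syzygies of [res2] are followed by three that express z^2, xz and x^2 times xy^2 - y^3 in
    the earlier generators. *)
Definition res3 : zresolution := 
  (ZResolution 6 8 3
  [:: P 3 0 0; P 0 0 3; P 2 1 0; P 0 1 2; P 1 1 1; P 1 2 0 ++ N 0 3 0]
  [:: [:: O; N 0 1 0; O; P 0 0 1; O; O];
      [:: P 0 1 0; O; N 1 0 0; O; O; O];
      [:: N 0 0 3; P 3 0 0; O; O; O; O];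
      [:: O; O; O; N 1 0 0; P 0 0 1; O];
      [:: O; O; N 0 0 1; O; P 1 0 0; O];
      [:: O; O; O; N 1 1 0 ++ P 0 2 0; O; P 0 0 2];
      [:: O; O; N 0 1 1; O; P 0 2 0; P 1 0 1];
      [:: N 0 2 0; O; P 0 2 0; O; O; P 2 0 0]]
  [:: [:: P 3 0 0; P 0 0 3; P 0 1 0; P 2 0 1; N 1 0 2; O; O; O];
      [:: O; O; O; P 1 1 0 ++ N 0 2 0; N 0 1 1; N 1 0 0; P 0 0 1; O];
      [:: O; P 0 1 1; O; O; P 0 2 0; O; N 1 0 0; P 0 0 1]]
  [:: (0,1,2, P 0 0 0); (0,2,1, N 2 0 0); (0,3,1, N 0 0 2); (0,3,3, N 2 0 0);
      (0,3,4, P 1 0 1); (0,4,1, N 1 0 1); (0,4,4, P 2 0 0); (0,5,1, P 0 2 0);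
      (0,5,7, P 1 0 0); (1,2,0, P 2 0 0); (1,2,3, P 1 0 1); (1,2,4, N 0 0 2);
      (1,3,0, P 0 0 2); (1,4,0, P 1 0 1); (1,4,3, P 0 0 2);
      (1,5,0, P 1 1 0 ++ N 0 2 0); (1,5,5, P 0 0 1); (2,3,3, N 1 1 0);
      (2,3,4, P 0 1 1); (2,4,4, P 1 1 0); (2,5,1, P 0 2 0); (2,5,7, P 0 1 0);
      (3,4,3, P 0 1 1); (3,5,5, P 0 1 0); (4,5,4, N 0 2 0); (4,5,6, P 0 1 0)]
  [:: (0,0,0, P 0 0 0); (0,5,1, N 2 0 0); (0,5,2, N 1 0 1); (0,6,2, N 2 0 0);
      (1,1,0, P 0 0 0); (1,6,1, P 0 0 2); (1,7,0, N 0 1 0); (1,7,1, P 1 0 1);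
      (1,7,2, P 0 0 2); (2,2,0, P 2 0 0); (2,5,1, N 1 1 0); (2,5,2, N 0 1 1);
      (2,6,2, N 1 1 0); (3,2,0, P 0 0 2); (3,6,1, P 0 1 1); (3,7,1, P 1 1 0);
      (3,7,2, P 0 1 1); (4,2,0, P 1 0 1); (4,5,1, N 0 1 1); (4,7,2, P 1 1 0);
      (5,2,0, P 1 1 0 ++ N 0 2 0); (5,2,1, N 2 0 1); (5,2,2, N 1 0 2);
      (5,3,1, P 0 1 0); (5,4,2, N 0 1 0); (5,6,2, N 0 2 0)])%N.

(** Three linear syzygies involving y^2 z appear; together with the older ones they generate rows 5
    and 6 of d_2 in [res3]. *)
Definition res4 : zresolution := 
  (ZResolution 7 9 3
  [:: P 3 0 0; P 0 0 3; P 2 1 0; P 0 1 2; P 1 1 1; P 1 2 0 ++ N 0 3 0; P 0 2 1]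
  [:: [:: O; N 0 1 0; O; P 0 0 1; O; O; O];
      [:: P 0 1 0; O; N 1 0 0; O; O; O; O];
      [:: N 0 0 3; P 3 0 0; O; O; O; O; O];
      [:: O; O; O; N 1 0 0; P 0 0 1; O; O];
      [:: O; O; O; N 0 1 0; O; O; P 0 0 1];
      [:: O; O; N 0 0 1; O; P 1 0 0; O; O];
      [:: O; O; O; O; N 0 1 0; O; P 1 0 0];
      [:: O; O; O; O; N 0 1 0; P 0 0 1; P 0 1 0];
      [:: N 0 2 0; O; P 0 2 0; O; O; P 2 0 0; O]]
  [:: [:: P 3 0 0; P 0 0 3; P 0 1 0; P 2 0 1; O; N 1 0 2; O; O; O];
      [:: O; O; O; P 0 1 0; N 1 0 0; O; P 0 0 1; O; O];
      [:: O; P 0 1 1; O; O; O; N 1 1 0 ++ P 0 2 0; P 1 1 0; N 2 0 0; P 0 0 1]]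
  [:: (0,1,2, P 0 0 0); (0,2,1, N 2 0 0); (0,3,1, N 0 0 2); (0,3,3, N 2 0 0);
      (0,3,5, P 1 0 1); (0,4,1, N 1 0 1); (0,4,5, P 2 0 0); (0,5,1, P 0 2 0);
      (0,5,8, P 1 0 0); (0,6,1, N 0 1 1); (0,6,5, P 1 1 0); (0,6,6, P 2 0 0);
      (1,2,0, P 2 0 0); (1,2,3, P 1 0 1); (1,2,5, N 0 0 2); (1,3,0, P 0 0 2);
      (1,4,0, P 1 0 1); (1,4,3, P 0 0 2); (1,5,0, P 1 1 0 ++ N 0 2 0);
      (1,5,3, P 0 1 1); (1,5,4, N 0 1 1); (1,5,7, P 0 0 2); (1,6,0, P 0 1 1);
      (1,6,4, P 0 0 2); (2,3,3, N 1 1 0); (2,3,5, P 0 1 1); (2,4,5, P 1 1 0);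
      (2,5,1, P 0 2 0); (2,5,8, P 0 1 0); (2,6,5, P 0 2 0); (2,6,6, P 1 1 0);
      (3,4,3, P 0 1 1); (3,5,3, P 0 2 0); (3,5,4, N 0 2 0); (3,5,7, P 0 1 1);
      (3,6,4, P 0 1 1); (4,5,6, N 0 2 0); (4,5,7, P 1 1 0); (4,6,3, N 0 2 0);
      (4,6,4, P 1 1 0); (5,6,6, P 0 2 0); (5,6,7, N 0 2 0)]
  [:: (0,0,0, P 0 0 0); (0,4,1, N 2 0 0); (0,7,2, N 1 0 0); (1,1,0, P 0 0 0);
      (1,6,1, P 0 0 2); (1,8,0, N 0 1 0); (1,8,1, N 1 1 1); (1,8,2, P 0 0 2);
      (2,2,0, P 2 0 0); (2,4,1, N 1 1 0); (2,7,2, N 0 1 0); (3,2,0, P 0 0 2);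
      (3,6,1, P 0 1 1); (3,8,1, N 1 2 0); (3,8,2, P 0 1 1); (4,2,0, P 1 0 1);
      (4,6,1, P 1 1 0); (4,7,1, P 0 2 0); (4,8,2, P 1 1 0);
      (5,2,0, P 1 1 0 ++ N 0 2 0); (5,2,1, P 2 1 1); (5,2,2, N 1 0 2);
      (5,3,1, N 0 2 0); (5,4,1, N 0 2 0); (5,5,2, N 0 1 0); (6,2,0, P 0 1 1);
      (6,2,1, N 2 0 2); (6,5,1, N 1 1 0); (6,6,1, P 0 2 0); (6,7,1, P 0 2 0);
      (6,8,2, P 0 2 0)])%N.

End Data.

(** * The ideals b_1, b_2, b_3, b_4 *)

Lemma check_res1 : zcheck res1. Proof. by vm_compute. Qed.
Lemma check_res2 : zcheck res2. Proof. by vm_compute. Qed.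
Lemma check_res3 : zcheck res3. Proof. by vm_compute. Qed.
Lemma check_res4 : zcheck res4. Proof. by vm_compute. Qed.

Lemma gen_ideal_subset (S : comNzRingType) (s t : seq S) :
  {subset s <= gen_ideal t} -> {subset gen_ideal s <= gen_ideal t}.
Proof.
move=> st q /asboolP[c ->].
have /choice[e eP] : forall i : 'I_(size s), exists e : 'I_(size t) -> S,
    s`_i = \sum_j e j * t`_j.
  by move=> i; apply/asboolP/st/mem_nth.
apply/asboolP; exists (fun j => \sum_i c i * e i j).
under eq_bigr do rewrite eP mulr_sumr.
rewrite exchange_big /=; apply: eq_bigr => j _.
by rewrite mulr_suml; apply: eq_bigr => i _; rewrite mulrA.
Qed.

Lemma eq_gen_ideal (S : comNzRingType) (s t : seq S) :
  s =i t -> gen_ideal s =i gen_ideal t.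
Proof.
by move=> st q; apply/idP/idP; apply: gen_ideal_subset => a;
  [rewrite st | rewrite -st]; apply: mem_gen_ideal.
Qed.

Section Ideals.
Variable k : fieldType.
Local Notation Q := (pseries3 k).

Lemma zeval_mono a b c : zeval k (zmono a b c) = ps_mono k a b c.
Proof. exact: big_seq1. Qed.

Lemma zeval_cons1 a b c p :
  zeval k ((1, (a, b, c)) :: p) = ps_mono k a b c + zeval k p.
Proof. exact: big_cons. Qed.

Definition zevalE := (zeval_opp, zeval_mono, zeval_cons1, zeval0).

Lemma b_proj_eq0 n q : b_proj k n q = 0 <-> q \in gen_ideal (b_gens k n).
Proof.
rewrite -(rmorph0 (b_proj k n)); split=> [/eqP|H]; last apply/eqP.
  by rewrite -Quotient.idealrBE subr0.
by rewrite -Quotient.idealrBE subr0.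
Qed.

Lemma b_proj_surj n a : exists q, b_proj k n q = a.
Proof. exists (repr a); exact: reprK. Qed.

Lemma b_proj_kerE n D : b_gens k n =i [seq zeval k p | p <- zd1 D] ->
  forall q, b_proj k n q = 0 <-> q \in gen_ideal [seq zeval k p | p <- zd1 D].
Proof. by move=> E q; rewrite b_proj_eq0 (eq_gen_ideal E). Qed.

(** Equality only as sets, since the data move z^3 forward. *)
Lemma b1_gensE : b_gens k 1 =i [seq zeval k p | p <- zd1 res1].
Proof.
move=> q; rewrite /= !zevalE !inE !ps_monoX !ps_monoM.
by rewrite !(muln1, muln0, addn0, add0n) /=; do 4!case: (q == _).
Qed.
Lemma b2_gensE : b_gens k 2 =i [seq zeval k p | p <- zd1 res2].
Proof.
move=> q; rewrite /= !zevalE !inE !ps_monoX !ps_monoM.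
by rewrite !(muln1, muln0, addn0, add0n) /=; do 5!case: (q == _).
Qed.
Lemma b3_gensE : b_gens k 3 =i [seq zeval k p | p <- zd1 res3].
Proof.
move=> q; rewrite /= !zevalE !inE !ps_monoX !ps_monoM.
by rewrite !(muln1, muln0, addn0, add0n) /=; do 6!case: (q == _).
Qed.
Lemma b4_gensE : b_gens k 4 =i [seq zeval k p | p <- zd1 res4].
Proof.
move=> q; rewrite /= !zevalE !inE !ps_monoX !ps_monoM.
by rewrite !(muln1, muln0, addn0, add0n) /=; do 7!case: (q == _).
Qed.

Definition ps_x : Q := ps_mono k 1 0 0.
Definition ps_y : Q := ps_mono k 0 1 0.
Definition ps_z : Q := ps_mono k 0 0 1.
Local Notation x := ps_x.
Local Notation y := ps_y.
Local Notation z := ps_z.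

Lemma ps_mono_factor a b c : ps_mono k a b c = x ^+ a * y ^+ b * z ^+ c.
Proof. by rewrite !ps_monoX !ps_monoM !(muln1, muln0, addn0, add0n). Qed.

Lemma row_nth n (v : 'rV[Q]_n) : exists c : nat -> Q, v = \row_i c i.
Proof.
exists (fun i => if insub i is Some u then v 0 u else 0).
by apply/rowP => i; rewrite mxE valK.
Qed.

(* Once y is inverted, b_1 is generated by x^2 and z^2: a syzygy yields one of
   these two elements, hence a Koszul relation. *)
Lemma y_kills_homology_res1 (v : 'rV[Q]_(zr1 res1)) : v *m real1 k res1 = 0 ->
  exists w : 'rV_(zr2 res1), w *m real2 k res1 = y *: v.
Proof.
have [c ->] := row_nth v.
move/matrixP/(_ 0 0); rewrite !mxE !big_ord_recl big_ord0 !mxE /ze1 /= !zevalE.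
rewrite !ps_mono_factor => E0.
have [_ div_x _] := ps_mono_regular k 2 0 2.
have [inj_x _ _] := ps_mono_regular k 2 0 2.
(* The syzygy reads z^2 (z c_1 + y c_3) = - x^2 (x c_0 + y c_2), and z^2 is regular modulo x^2. *)
have [p Ep] : exists p, z * c 1%N + y * c 3 = ps_mono k 2 0 0 * p.
  apply: (div_x _ (- (x * c 0%N + y * c 2))).
  by rewrite !ps_mono_factor; apply/eqP; rewrite -subr_eq0 -E0; apply/eqP; ring.
have E2 : x * c 0%N + y * c 2 + ps_mono k 0 0 2 * p = 0.
  apply: inj_x; rewrite mulrDr [_ * (_ * p)]mulrCA -Ep -E0 !ps_mono_factor.
  by ring.
have Eq : c 2 * y = - (x * c 0%N) - ps_mono k 0 0 2 * p.
  by apply/eqP; rewrite -subr_eq0 -E2; apply/eqP; ring.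
move: Ep Eq; rewrite !ps_mono_factor => Ep Eq.
exists (\row_i [:: - c 1%N; c 0%N; 0; p]`_i).
apply/rowP; case=> [[|[|[|[|//]]]] lti];
  rewrite !mxE !big_ord_recl big_ord0 !mxE /ze2 /= ?zevalE !ps_mono_factor.
- by ring.
- by ring.
- by rewrite [RHS]mulrC Eq; ring.
- by apply: (addIr (z * c 1%N)); rewrite addrC [RHS]addrC Ep; ring.
Qed.

(** Once y is inverted, b_2 is generated by x^2, xz, z^2, whose syzygies are spanned by two linear
    relations. Dividing first z c_1 + y c_3 and then s by x yields the coefficients r and p of these
    relations. *)
Lemma y_kills_homology_res2 (v : 'rV[Q]_(zr1 res2)) : v *m real1 k res2 = 0 ->
  exists w : 'rV_(zr2 res2), w *m real2 k res2 = y *: v.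
Proof.
have [c ->] := row_nth v.
move/matrixP/(_ 0 0); rewrite !mxE !big_ord_recl big_ord0 !mxE /ze1 /= !zevalE.
rewrite !ps_mono_factor => E0.
have [inj div _] := ps_mono_regular k 1 0 1.
have inj_x a : x * a = 0 -> a = 0 := inj a.
have div_x a b : z * a = x * b -> exists c, a = x * c := div a b.
have [_ div_x2 _] := ps_mono_regular k 1 0 2.
have [r Er] : exists r, z * c 1%N + y * c 3 = x * r.
  apply: (div_x2 _ (- (x * (x * c 0%N + y * c 2) + y * z * c 4))).
  by rewrite !ps_mono_factor; apply/eqP; rewrite -subr_eq0 -E0; apply/eqP; ring.
pose s := - (z * r + y * c 4).
have Es : x * (x * c 0%N + y * c 2) = z * s.
  apply/eqP; rewrite -subr_eq0; apply/eqP/inj_x; rewrite /s -E0.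
  transitivity (x * (x * (x * c 0%N + y * c 2)) + z * z * (x * r)
    + x * y * z * c 4).
    by ring.
  by rewrite -Er; ring.
have [p Ep] := div_x _ _ (esym Es).
have Eq : x * c 0%N + y * c 2 = z * p.
  apply/eqP; rewrite -subr_eq0; apply/eqP/inj_x.
  by rewrite mulrBr Es Ep; ring.
have {}Ep : y * c 4 = - (x * p) - z * r by rewrite -Ep /s; ring.
exists (\row_i [:: - c 1%N; c 0%N; 0; - r; - p]`_i).
apply/rowP; case=> [[|[|[|[|[|//]]]]] lti];
  rewrite !mxE !big_ord_recl big_ord0 !mxE /ze2 /= ?zevalE !ps_mono_factor.
- by ring.
- by ring.
- by apply: (addrI (x * c 0%N)); rewrite Eq !expr0 !expr1; ring.
- by apply: (addrI (z * c 1%N)); rewrite Er !expr0 !expr1; ring.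
- by rewrite !expr0 !expr1 !mul1r !mulr1 Ep; ring.
Qed.

(** When y^n lies in the ideal, left multiplication by u is the null-homotopy. *)
Lemma kills_homology_ideal D (n : nat) (u : 'rV[Q]_(zr1 D)) :
    zcheck D -> aug (real1 k D) u = ps_mono k 0 n 0 ->
  forall v : 'rV[Q]_(zr1 D), v *m real1 k D = 0 ->
  exists w : 'rV_(zr2 D), w *m real2 k D = ps_mono k 0 n 0 *: v.
Proof.
move=> check <- v v0; exists (v *m mul1 (@realA k D) u).
apply: homotopy_cycle1 v0 => i.
by have [] := check_homotopy k check i.
Qed.

(** The witness encodes y^4 = y (x^2 y) - (x + y)(xy^2 - y^3). *)
Lemma y4_in_ideal_res3 : exists u : 'rV[Q]_(zr1 res3),
  aug (real1 k res3) u = ps_mono k 0 4 0.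
Proof.
exists (\row_i [:: 0; 0; y; 0; 0; - (x + y)]`_i).
rewrite /aug !mxE !big_ord_recl big_ord0 !mxE /ze1 /= !zevalE !ps_mono_factor.
by ring.
Qed.

Lemma y4_in_ideal_res4 : exists u : 'rV[Q]_(zr1 res4),
  aug (real1 k res4) u = ps_mono k 0 4 0.
Proof.
exists (\row_i [:: 0; 0; y; 0; 0; - (x + y); 0]`_i).
rewrite /aug !mxE !big_ord_recl big_ord0 !mxE /ze1 /= !zevalE !ps_mono_factor.
by ring.
Qed.

(** The exponent b is 1 for b_1 and b_2, and 4 for b_3 and b_4. *)
Lemma b_quot_properties n D b : zcheck D ->
    b_gens k n =i [seq zeval k p | p <- zd1 D] ->
    (forall v : 'rV[Q]_(zr1 D), v *m real1 k D = 0 ->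
      exists w : 'rV_(zr2 D), w *m real2 k D = ps_mono k 0 b 0 *: v) ->
  [/\ local_ring (b_quot k n), embcodepth (b_quot k n) 3
    & class_B (@ps_const k) (b_proj k n)] /\ cmtype (b_quot k n) (zr3 D).
Proof.
move=> check /b_proj_kerE kerE kill; have surj := @b_proj_surj n.
split; first split.
- exact: (quot_local surj (check_ker check kerE)).
- exact: (check_embcodepth check surj kerE kill).
- exact: (check_class_B check surj kerE kill).
by have [] := check_cmtype check surj kerE kill.
Qed.

Lemma b1_properties : [/\ local_ring (b_quot k 1), embcodepth (b_quot k 1) 3
    & class_B (@ps_const k) (b_proj k 1)] /\ cmtype (b_quot k 1) 1.
Proof. exact: (b_quot_properties check_res1 b1_gensE y_kills_homology_res1). Qed.

Lemma b2_properties : [/\ local_ring (b_quot k 2), embcodepth (b_quot k 2) 3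
    & class_B (@ps_const k) (b_proj k 2)] /\ cmtype (b_quot k 2) 1.
Proof. exact: (b_quot_properties check_res2 b2_gensE y_kills_homology_res2). Qed.

Lemma b3_properties : [/\ local_ring (b_quot k 3), embcodepth (b_quot k 3) 3
    & class_B (@ps_const k) (b_proj k 3)] /\ cmtype (b_quot k 3) 3.
Proof.
have [u Eu] := y4_in_ideal_res3.
exact: (b_quot_properties check_res3 b3_gensE (kills_homology_ideal check_res3 Eu)).
Qed.

Lemma b4_properties : [/\ local_ring (b_quot k 4), embcodepth (b_quot k 4) 3
    & class_B (@ps_const k) (b_proj k 4)] /\ cmtype (b_quot k 4) 3.
Proof.
have [u Eu] := y4_in_ideal_res4.
exact: (b_quot_properties check_res4 b4_gensE (kills_homology_ideal check_res4 Eu)).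
Qed.

End Ideals.

Theorem mainTheorem2 (k : fieldType) :
  (forall n : nat, (1 <= n <= 4)%N ->
     [/\ local_ring (b_quot k n),
         embcodepth (b_quot k n) 3
       & class_B (@ps_const k) (b_proj k n)]) /\
  [/\ cmtype (b_quot k 1) 1, cmtype (b_quot k 2) 1,
      cmtype (b_quot k 3) 3 & cmtype (b_quot k 4) 3].
Proof.
have [P1 t1] := b1_properties k; have [P2 t2] := b2_properties k.
have [P3 t3] := b3_properties k; have [P4 t4] := b4_properties k.
by split=> // -[|[|[|[|[|n]]]]].
Qed.
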